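(* Let $\boldsymbol{P}$ be an M/G/1-type transition probability matrix (block form given in the context) with blocks $\{\boldsymbol{A}(k);k\ge -1\}$, $\{\boldsymbol{B}(k);k\ge -1\}$, and suppose that: (i) the stochastic matrix $\boldsymbol{P}$ is irreducible; (ii) $\boldsymbol{A}:=\sum_{k=-1}^\infty \boldsymbol{A}(k)$ is an irreducible stochastic matrix, with unique stationary distribution vector $\boldsymbol{\varpi}$; (iii) $\overline{\boldsymbol{m}}_B:=\sum_{k=1}^\infty k\boldsymbol{B}(k)\boldsymbol{e}<\infty$ (entrywise); (iv) $\sigma:=\boldsymbol{\varpi}\,\overline{\boldsymbol{m}}_A<0$, where $\overline{\boldsymbol{m}}_A=\sum_{k=-1}^\infty k\boldsymbol{A}(k)\boldsymbol{e}$. Suppose further that there exists a distribution function $F$ on $\mathbb{Z}_+$ that is long-tailed and satisfies $$\lim_{N\to\infty}\frac{\overline{\overline{\boldsymbol{A}}}(N)\boldsymbol{e}}{\overline{F}(N)}=\boldsymbol{c}_A,\qquad \lim_{N\to\infty}\frac{\overline{\overline{\boldsymbol{B}}}(N)\boldsymbol{e}}{\overline{F}(N)}=\boldsymbol{c}_B,$$ where $\boldsymbol{c}_A\ge\boldsymbol{0}$ and $\boldsymbol{c}_B\ge\boldsymbol{0}$ are $M_1$- and $M_0$-dimensional finite column vectors, respectively, at least one of which is non-zero. Let $\boldsymbol{\pi}$ be the unique stationary distribution vector of $\boldsymbol{P}$, let $\overline{\boldsymbol{\pi}}(N)=\sum_{\ell=N+1}^\infty\boldsymbol{\pi}(\ell)$,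 and let $\boldsymbol{\pi}^{(N)}$, $N\in\mathbb{N}$, be the stationary distribution vector of the level-increment truncation approximation $\boldsymbol{P}^{(N)}$. If $F$ is subexponential, then, for every $k\in\mathbb{Z}_+$, $$\lim_{N\to\infty}\frac{\boldsymbol{\pi}^{(N)}(k)-\boldsymbol{\pi}(k)}{\overline{\boldsymbol{\pi}}(N)\boldsymbol{e}}=\boldsymbol{\pi}(k),$$ $$\lim_{N\to\infty}\frac{1}{\overline{\boldsymbol{\pi}}(N)\boldsymbol{e}}\left\|\frac{\boldsymbol{\pi}^{(N)}(k)-\boldsymbol{\pi}(k)}{\boldsymbol{\pi}(k)\boldsymbol{e}}\right\|=1.$$
   Context: Notation. $\mathbb{Z}_+=\{0,1,2,\dots\}$, $\mathbb{N}=\{1,2,\dots\}$. $\boldsymbol{e}$ is the column vector of ones, $\boldsymbol{0}$ a zero vector, $\boldsymbol{O}$ a zero matrix (of appropriate sizes). Vector inequalities, limits and finiteness are entrywise. For a row vector $\boldsymbol{x}$, $\|\boldsymbol{x}\|=|\boldsymbol{x}|\boldsymbol{e}$ is the sum of the absolute values of its entries. M/G/1-type matrix. Fix $M_0,M_1\in\mathbb{N}$, $\mathbb{M}_0=\{1,\dots,M_0\}$, $\mathbb{M}_1=\{1,\dots,M_1\}$. The state space is $\mathbb{S}=\bigcup_{k=0}^\infty\{k\}\times\mathbb{M}_{\min(k,1)}$; level $k$ is $\mathbb{L}_k=\{k\}\times\mathbb{M}_{\min(k,1)}$. $\boldsymbol{P}$ is a stochastic matrix on $\mathbb{S}$ whose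 blocks (rows from $\mathbb{L}_k$, columns to $\mathbb{L}_\ell$) are: $(0,\ell)$-block $\boldsymbol{B}(\ell)$ for $\ell\ge0$; $(1,0)$-block $\boldsymbol{B}(-1)$; $(k,\ell)$-block $\boldsymbol{A}(\ell-k)$ for $k\ge1$, $\ell\ge 1$, $\ell\ge k-1$; all other blocks are $\boldsymbol{O}$. All blocks are nonnegative; $\boldsymbol{A}(k)$ is $M_1\times M_1$, $\boldsymbol{B}(0)$ is $M_0\times M_0$, $\boldsymbol{B}(-1)$ is $M_1\times M_0$, and $\boldsymbol{B}(k)$ is $M_0\times M_1$ for $k\ge1$. Under (i)--(iv), $\boldsymbol{P}$ is irreducible and positive recurrent, so it has a unique stationary distribution vector $\boldsymbol{\pi}$, partitioned by levels as $(\boldsymbol{\pi}(0),\boldsymbol{\pi}(1),\dots)$. Tail matrices. $\overline{\boldsymbol{A}}(k)=\sum_{\ell=k+1}^\infty\boldsymbol{A}(\ell)$, $\overline{\boldsymbol{B}}(k)=\sum_{\ell=k+1}^\infty\boldsymbol{B}(\ell)$, $\overline{\overline{\boldsymbol{A}}}(k)=\sum_{\ell=k+1}^\infty\overline{\boldsymbol{A}}(\ell)$, $\overline{\overline{\boldsymbol{B}}}(k)=\sum_{\ell=k+1}^\infty\overline{\boldsymbol{B}}(\ell)$ (for $k\ge 0$). Level-increment (LI) truncation. For $N\in\mathbb{N}$, $\boldsymbol{P}^{(N)}$ is the M/G/1-type stochastic matrix with the same block layout as $\boldsymbol{P}$ but with $\boldsymbol{A}(k),\boldsymbol{B}(k)$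 replaced by $\boldsymbol{A}^{(N)}(k),\boldsymbol{B}^{(N)}(k)$, where $\boldsymbol{A}^{(N)}(k)=\boldsymbol{A}(k)$ for $-1\le k\le N-1$, $\boldsymbol{A}^{(N)}(N)=\overline{\boldsymbol{A}}(N-1)$, $\boldsymbol{A}^{(N)}(k)=\boldsymbol{O}$ for $k\ge N+1$, and likewise $\boldsymbol{B}^{(N)}(k)=\boldsymbol{B}(k)$ for $-1\le k\le N-1$, $\boldsymbol{B}^{(N)}(N)=\overline{\boldsymbol{B}}(N-1)$, $\boldsymbol{B}^{(N)}(k)=\boldsymbol{O}$ for $k\ge N+1$. $\boldsymbol{\pi}^{(N)}$ is a stationary distribution vector of $\boldsymbol{P}^{(N)}$ (a probability row vector with $\boldsymbol{\pi}^{(N)}\boldsymbol{P}^{(N)}=\boldsymbol{\pi}^{(N)}$), partitioned by levels. Long-tailed and subexponential. $\overline{F}=1-F$. A distribution function $F$ on $\mathbb{Z}_+$ is long-tailed if $\overline{F}(k)>0$ for all $k\in\mathbb{Z}_+$ and $\lim_{k\to\infty}\overline{F}(k+n)/\overline{F}(k)=1$ for every $n\in\mathbb{Z}_+$. It is subexponential if $\overline{F}(k)>0$ for all $k\in\mathbb{Z}_+$ and $\lim_{k\to\infty}\overline{F^{*2}}(k)/\overline{F}(k)=2$, where $F^{*2}$ is the two-fold convolution of $F$ with itself, i.e. the distribution function of the sum of two independent random variables each with distribution function $F$. *)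

(* Defs.v *)
From mathcomp Require Import all_boot all_order all_algebra.
From mathcomp Require Import all_classical all_reals all_analysis.

Set Implicit Arguments.
Unset Strict Implicit.
Unset Printing Implicit Defensive.

Import Order.TTheory GRing.Theory Num.Theory.
Import numFieldNormedType.Exports.

Local Open Scope classical_set_scope.
Local Open Scope ring_scope.

Section Chains.
Variables (R : realType) (T : choiceType).
Implicit Types (p : T -> T -> R) (x : T -> R).

Definition stochastic p : Prop :=
  (forall s t, 0 <= p s t) /\
  (forall s, \esum_(t in [set: T]) (p s t)%:E = 1%E).

(* Any two indices are joined by a path of positive entries (possibly of
   length 0 when they coincide, so a 1 x 1 matrix is irreducible). *)
Definition irreducible_mat p : Prop :=
  forall s t, exists q : seq T, path (fun u v => 0 < p u v) s q /\ last s q = t.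

Definition stationary p x : Prop :=
  [/\ forall s, 0 <= x s,
      \esum_(s in [set: T]) (x s)%:E = 1%E
    & forall t, \esum_(s in [set: T]) (x s * p s t)%:E = (x t)%:E].

End Chains.

Section Matrices.
Variable R : realType.

Definition ones n : 'cV[R]_n := const_mx 1.

Definition l1norm n (x : 'rV[R]_n) : R := (map_mx Num.norm x *m ones n) 0 0.

(* The sum of F l over l >= k, meaningful when every entry converges. *)
Definition sum_from m n (k : nat) (F : nat -> 'M[R]_(m, n)) : 'M[R]_(m, n) :=
  \matrix_(i, j) limn (fun K => \sum_(k <= l < K) F l i j).

End Matrices.

Definition lvl (M0 M1 k : nat) : nat := if k is 0%N then M0 else M1.

Definition state (M0 M1 : nat) : choiceType := {k : nat & 'I_(lvl M0 M1 k)}.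

(* blkA k is A(k) (only k >= -1 is used); B is split according to the shapes
   of its blocks: blkBm1 is B(-1), blkB0 is B(0), and blkB k is B(k) (only
   k >= 1 is used). *)
Record blocks (R : realType) (M0 M1 : nat) := Blocks {
  blkA : int -> 'M[R]_M1;
  blkBm1 : 'M[R]_(M1, M0);
  blkB0 : 'M[R]_M0;
  blkB : nat -> 'M[R]_(M0, M1) }.

Section MG1.
Variables (R : realType) (M0 M1 : nat).
Implicit Types (Q : blocks R M0 M1) (x : state M0 M1 -> R).

(* In the last case the row level is k'+1 and the column level l'+1. *)
Definition block Q (k l : nat) : 'M[R]_(lvl M0 M1 k, lvl M0 M1 l) :=
  match k as k0, l as l0 return 'M[R]_(lvl M0 M1 k0, lvl M0 M1 l0) with
  | 0, 0 => blkB0 Q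
  | 0, l'.+1 => blkB Q l'.+1
  | 1, 0 => blkBm1 Q
  | _.+2, 0 => 0
  | k'.+1, l'.+1 => if (k' <= l'.+1)%N then blkA Q (l'%:Z - k'%:Z) else 0
  end.

Definition MG1mat Q (s t : state M0 M1) : R :=
  block Q (tag s) (tag t) (tagged s) (tagged t).

Definition sumA Q : 'M[R]_M1 :=
  blkA Q (- 1) + sum_from 0 (fun k => blkA Q k%:Z).

Definition tailA Q (k : nat) : 'M[R]_M1 :=
  sum_from k.+1 (fun l => blkA Q l%:Z).
Definition tailB Q (k : nat) : 'M[R]_(M0, M1) := sum_from k.+1 (blkB Q).
Definition ttailA Q (k : nat) : 'M[R]_M1 := sum_from k.+1 (tailA Q).
Definition ttailB Q (k : nat) : 'M[R]_(M0, M1) := sum_from k.+1 (tailB Q).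

(* The means are extended reals: the series have nonnegative terms (up to the
   finite k = -1 term), so +oo is the only non-finite value. *)
Definition meanA Q (i : 'I_M1) : \bar R :=
  ((- (blkA Q (- 1) *m ones R M1) i 0)%:E +
   \sum_(0 <= k <oo) (k%:R * (blkA Q k%:Z *m ones R M1) i 0)%:E)%E.

Definition meanB Q (i : 'I_M0) : \bar R :=
  (\sum_(1 <= k <oo) (k%:R * (blkB Q k *m ones R M1) i 0)%:E)%E.

Definition drift Q (w : 'rV[R]_M1) : \bar R :=
  (\sum_(i < M1) (w 0 i)%:E * meanA Q i)%E.

(* Only for N >= 1: otherwise B(0) would have to be replaced too. *)
Definition LItrunc (N : nat) Q : blocks R M0 M1 := {|
  blkA := fun k => if k < N%:Z then blkA Q k
                   else if k == N%:Z then tailA Q N.-1 else 0;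
  blkBm1 := blkBm1 Q;
  blkB0 := blkB0 Q;
  blkB := fun k => if (k < N)%N then blkB Q k
                   else if k == N then tailB Q N.-1 else 0 |}.

Definition level x (k : nat) : 'rV[R]_(lvl M0 M1 k) :=
  \row_i x (existT (fun k => 'I_(lvl M0 M1 k)) k i).

(* The sum of the levels l >= N+1; shifting by one exposes their common
   dimension M1. *)
Definition tail_levels x (N : nat) : 'rV[R]_M1 :=
  sum_from N (fun l => level x l.+1).

End MG1.

Section Tails.
Variable R : realType.
Implicit Type F : nat -> R.

Definition distribution_function F : Prop :=
  [/\ forall k, 0 <= F k, {homo F : m n / (m <= n)%N >-> m <= n}
    & F @ \oo --> (1 : R)].

Definition tailF F (k : nat) : R := 1 - F k.

Definition mass F (k : nat) : R := if k is j.+1 then F j.+1 - F j else F 0%N.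

(* The distribution function of a sum of two independent copies: condition on
   the value j of the first one. *)
Definition convolution2 F (k : nat) : R := \sum_(j < k.+1) mass F j * F (k - j)%N.

Definition long_tailed F : Prop :=
  (forall k, 0 < tailF F k) /\
  (forall n : nat, (fun k => tailF F (k + n)%N / tailF F k) @ \oo --> (1 : R)).

Definition subexponential F : Prop :=
  (forall k, 0 < tailF F k) /\
  ((fun k => tailF (convolution2 F) k / tailF F k) @ \oo --> (2 : R)).

End Tails.

(* Main.v *)
Require Import Defs.
From mathcomp Require Import all_boot all_order all_algebra.
From mathcomp Require Import all_classical all_reals all_analysis.
From mathcomp Require Import ring lra zify.

Set Implicit Arguments.
Unset Strict Implicit.
Unset Printing Implicit Defensive.

Import Order.TTheory GRing.Theory Num.Theory.
Import numFieldNormedType.Exports.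

Local Open Scope classical_set_scope.
Local Open Scope ring_scope.

(* Let D_A(n) = sum_{m >= n} Abar(m)e, similarly D_B, and let y_n be the phase
   vector of the levels above n.  Summing the balance equations over these levels
   gives a level-crossing identity, summing once more a total-crossing identity.
   Eliminating the phases by a solution a of the Poisson equation
   (I - A)a = mean - sigma e yields
     - sigma y_n e = pi(0) D_B(n) + sum_{1 <= k <= n} pi(k) D_A(n - k) + error,
   with an error bounded by C pi(n+1)e.  Subexponentiality of F and averaging over
   windows of consecutive n turn it into y_n e ~ mu Fbar(n) / (- sigma),
   mu = pi(0) c_B + y_0 c_A, without any use of the G- and R-matrices.

   At n = 0 the same identities for pi and pi^(N) differ by pi^(N)(0) D_B(N) +
   y_0^(N) D_A(N) ~ mu Fbar(N).  On the other hand pi^(N) is proportional to pi up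
   to o(Fbar(N)) on any two states s0, a: integrate the probability of hitting s0
   before a, which is harmonic off the two states, against both chains; the error
   is the mass of the overshooting jumps, a difference of consecutive excesses.
   Hence pi^(N)(s) - pi(s) ~ pi(s) mu Fbar(N) / (- sigma). *)

(** * Tails of subexponential renewal-type sequences *)

(** The total-crossing identity sees the phases through y_n times the mean vector. The Poisson
    equation replaces that vector by sigma e up to (I - A)a, and the level-crossing identity
    evaluates y_n (I - A)a as the upward flow across the level minus the downward flow, both
    weighted by a. The two flows have equal mass and the downward one is at most pi(n+1)e, whence
    the error bound. The obstacle is that nothing bounds pi(n+1)e by o(Fbar(n)) in advance. Its sums
    over consecutive n telescope to differences of tails, and tails are monotone, so averages
    control single values. These estimates presuppose y_n e = O(Fbar(n)), which comes from a strong
    induction: the unknown constant B enters each bound only through a small multiple of 1 + B. For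
    the truncation, proportionality leaves one scale factor free; the Poisson solution again removes
    the phases, and the total mass 1 supplies the term - sigma that fixes this factor. *)

Section TailAsymptotics.
Variable R : realType.

Lemma cvgn_sum (I : Type) (r : seq I) (P : pred I) (f : I -> nat -> R)
    (l : I -> R) : (forall i, P i -> f i @ \oo --> l i) ->
  (fun n => \sum_(i <- r | P i) f i n) @ \oo --> \sum_(i <- r | P i) l i.
Proof.
move=> fl; elim: r => [|i r IH].
  under eq_fun do rewrite big_nil.
  by rewrite big_nil; exact: cvg_cst.
under eq_fun do rewrite big_cons.
rewrite big_cons; case: ifP => [Pi|//]; exact: cvgD (fl _ Pi) IH.
Qed.

Lemma cvgn_ratio_bounds (u G : nat -> R) (l e : R) : (forall n, 0 < G n) ->
  (fun n => u n / G n) @ \oo --> l -> 0 < e ->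
  \forall n \near \oo, `|u n - l * G n| <= e * G n.
Proof.
move=> G0 /cvgrPdist_le ul e0; have := ul _ e0; apply: filterS => n /= h.
have -> : u n - l * G n = - ((l - u n / G n) * G n).
  by rewrite mulrBl divfK ?gt_eqF// opprB.
by rewrite normrN normrM (gtr0_norm (G0 n)) ler_pM2r.
Qed.

(** A lag of K+1 is a sum of K+1 unit lags, and each of these telescopes to at most T N. The bound
    does not depend on the window length W, so dividing by W makes it negligible. *)
Lemma sum_lag_le (T : nat -> R) (N K W : nat) :
  {homo T : m n / (m <= n)%N >-> n <= m} -> (forall n, 0 <= T n) ->
  \sum_(0 <= i < W) (T (N + i)%N - T (N + i + K.+1)%N) <= K.+1%:R * T N.
Proof.
move=> Tdec T0.
have tel M : \sum_(0 <= i < W) (T (M + i)%N - T (M + i).+1) <= T M.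
  rewrite (eq_bigr (fun i => - (T (M + i.+1)%N - T (M + i)%N))); last first.
    by move=> i _; rewrite opprB addnS.
  rewrite sumrN (telescope_sumr (fun i => T (M + i)%N)) // opprB addn0.
  by rewrite gerBl.
elim: K => [|K IH].
  under eq_bigr do rewrite addn1.
  by rewrite mul1r.
rewrite (eq_bigr (fun i => (T (N + i)%N - T (N + i + K.+1)%N) +
   (T (N + K.+1 + i)%N - T (N + K.+1 + i).+1))); last first.
  move=> i _; rewrite [(N + K.+1 + i)%N]addnAC addnS; ring.
rewrite big_split /= -[in leRHS]addn1 natrD mulrDl mul1r lerD//.
by apply: le_trans (tel _) _; apply: Tdec; exact: leq_addr.
Qed.

(** Abel summation. It moves the increments from T, about which little is known, to G, whose
    increments are the masses of F. *)
Lemma sum_by_parts (T G : nat -> R) (a b n : nat) : (a <= b)%N -> (b <= n)%N ->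
  \sum_(a <= k < b) (T k - T k.+1) * G (n - k)%N + T b * G (n.+1 - b)%N =
  T a * G (n.+1 - a)%N + \sum_(a <= k < b) T k * (G (n - k)%N - G (n.+1 - k)%N).
Proof.
move=> ab; elim: b ab => [|b IH].
  by rewrite leqn0 => /eqP -> _; rewrite !big_geq// add0r addr0.
rewrite leq_eqVlt => /orP[/eqP->|]; first by move=> _; rewrite !big_geq// add0r addr0.
rewrite ltnS => ab bn; rewrite !big_nat_recr//= addrA -IH//; last exact: ltnW.
rewrite subSS; ring.
Qed.

Section SubexponentialTail.
Variable F : nat -> R.
Hypothesis hF : distribution_function F.
Let G := tailF F.

Lemma tailF_noninc : {homo G : m n / (m <= n)%N >-> n <= m}.
Proof. by case: hF => _ Fh _ m n /Fh; rewrite /G /tailF; lra. Qed.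

Lemma tailF_le1 n : G n <= 1.
Proof. by case: hF => /(_ n) F0 _ _; rewrite /G /tailF; lra. Qed.

Lemma tailF_cvg0 : G @ \oo --> (0 : R).
Proof.
case: hF => _ _ F1; rewrite /G /tailF -[X in _ --> X](subrr (1 : R)).
by apply: cvgB => //; exact: cvg_cst.
Qed.

Lemma mass_ge0 j : 0 <= mass F j.
Proof. by case: hF => F0 Fh _; case: j => //= j; rewrite subr_ge0 Fh. Qed.

Lemma sum_mass n : \sum_(0 <= j < n.+1) mass F j = F n.
Proof.
elim: n => [|n IH]; first by rewrite big_nat1.
by rewrite big_nat_recr//= IH addrC subrK.
Qed.

Lemma tailF_convolution2 n :
  tailF (convolution2 F) n = G n + \sum_(0 <= j < n.+1) mass F j * G (n - j)%N.
Proof.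
rewrite /convolution2 /tailF -(big_mkord xpredT (fun j => mass F j * F (n - j)%N)).
rewrite /G /tailF; under [in RHS]eq_bigr do rewrite mulrBr mulr1.
rewrite sumrB sum_mass; ring.
Qed.

Hypothesis hL : long_tailed F.

Lemma tailF_gt0 n : 0 < G n. Proof. by case: hL. Qed.

Lemma long_tailed_shift (c : R) n : 1 < c -> \forall k \near \oo, G k <= c * G (k + n)%N.
Proof.
move=> c1; case: hL => _ /(_ n) h.
have e0 : 0 < 1 - c^-1 by rewrite subr_gt0 invf_lt1//; lra.
have := cvgn_ratio_bounds tailF_gt0 h e0; apply: filterS => k /=.
rewrite mul1r -/G mulrBl mul1r ler_norml => /andP[h1 _].
by rewrite -ler_pdivrMl; lra.
Qed.

(** The ratio of consecutive tails tends to 1; the constant 2 covers all large k and the finite sum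
    of ratios covers the others. *)
Lemma long_tailed_dominated : exists2 D, 0 < D & forall k, G k <= D * G k.+1.
Proof.
have [N _ hN] := long_tailed_shift 1 (ltr1n R 2).
have r0 k : 0 <= G k / G k.+1 by rewrite divr_ge0// ltW// tailF_gt0.
exists (2 + \sum_(0 <= k < N) G k / G k.+1).
  by rewrite ltr_pwDl// sumr_ge0.
move=> k; rewrite -ler_pdivrMr ?tailF_gt0//.
have [kN|Nk] := ltnP k N.
  rewrite (bigD1_seq k)//= ?mem_index_iota ?iota_uniq//=.
  rewrite addrCA lerDl addr_ge0// sumr_ge0//.
have := hN k Nk; rewrite /= addn1 => h.
rewrite ler_wpDr ?sumr_ge0// ler_pdivrMr ?tailF_gt0//.
Qed.

Hypothesis hS : subexponential F.

(** The tail of the two-fold convolution is about 2 G n. One G n is the event that the first summand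
    alone exceeds n, and the terms with j < K contribute at least F (K - 1) G n, which is almost a
    second one; little is left for the remaining j. This is the only direct appeal to
    subexponentiality. *)
Lemma subexponential_middle (e : R) : 0 < e -> exists K0, forall K, (K0 <= K)%N ->
  \forall n \near \oo, \sum_(K <= j < n.+1) mass F j * G (n - j)%N <= e * G n.
Proof.
move=> e0; case: hS => _; rewrite -/G => h2.
have [N _ hN] : \forall N \near \oo, 1 - e / 2 <= F N.
  case: hF => _ _ /cvgrPdist_le /(_ (e / 2)).
  rewrite divr_gt0// => /(_ isT); apply: filterS => k /=; rewrite ler_norml; lra.
exists N.+1 => -[//|K]; rewrite ltnS => NK.
have /= FK := hN K NK.
have e20 : 0 < e / 2 by rewrite divr_gt0.
have := cvgn_ratio_bounds tailF_gt0 h2 e20.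
apply: filterS2 (nbhs_infty_ge K) => n Kn.
rewrite /= tailF_convolution2 ler_norml => /andP[_].
rewrite (big_cat_nat _ (n := K.+1))//=.
have : (1 - e / 2) * G n <= \sum_(0 <= j < K.+1) mass F j * G (n - j)%N.
  apply: (@le_trans _ _ (F K * G n)).
    by rewrite ler_pM2r// tailF_gt0.
  rewrite -sum_mass mulr_suml ler_sum// => j _.
  by rewrite ler_wpM2l ?mass_ge0// tailF_noninc// leq_subr.
lra.
Qed.

(** Substituting j = n + 1 - k turns the left side into a part of the right side, and the omitted
    terms are nonnegative. *)
Lemma mass_reverse_sum_le K n : (K + K <= n)%N ->
  \sum_(K <= k < n - K) G k * mass F (n.+1 - k)%N <=
  \sum_(K <= j < n.+2) mass F j * G (n.+1 - j)%N.
Proof.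
move=> Kn.
have -> : \sum_(K <= k < n - K) G k * mass F (n.+1 - k)%N =
    \sum_(K.+2 <= j < (n - K).+2) mass F j * G (n.+1 - j)%N.
  rewrite big_nat_rev/= 2!big_add1/=; apply: eq_big_nat => k /andP[_ kn].
  rewrite (_ : n.+1 - (K + (n - K) - k.+1) = k.+2)%N; last by lia.
  rewrite (_ : K + (n - K) - k.+1 = n.+1 - k.+2)%N; last by lia.
  by rewrite mulrC.
rewrite [leRHS](big_cat_nat _ (n := K.+2))//=; [|lia|lia].
rewrite [X in _ + X](big_cat_nat _ (n := (n - K).+2))//=; [|lia|lia].
have nng a b : 0 <= \sum_(a <= j < b) mass F j * G (n.+1 - j)%N.
  by rewrite sumr_ge0// => j _; rewrite mulr_ge0 ?mass_ge0// ltW ?tailF_gt0.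
have := nng K K.+2; have := nng (n - K).+2 n.+2; lra.
Qed.

(** * Approximate renewal equations with a subexponential kernel *)

Section Renewal.
Variables (I : finType) (T : nat -> R) (y : nat -> I -> R) (Y c : I -> R).
Variables (bet : nat -> R) (del : I -> nat -> R) (b s C : R).
Hypothesis y0 : forall k i, 0 <= y k i.
Hypothesis T0 : forall k, 0 <= T k.
Hypothesis Ty : forall k, T k - T k.+1 = \sum_i y k i.
Hypothesis yY : forall i, (fun n => \sum_(0 <= k < n) y k i) @ \oo --> Y i.
Hypothesis bet0 : forall n, 0 <= bet n.
Hypothesis del0 : forall i n, 0 <= del i n.
Hypothesis betb : (fun n => bet n / G n) @ \oo --> b.
Hypothesis delc : forall i, (fun n => del i n / G n) @ \oo --> c i.
Hypothesis s0 : 0 < s.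
Hypothesis C0 : 0 <= C.
Hypothesis Teq : forall n,
  `|s * T n - (bet n + \sum_(0 <= k < n) \sum_i y k i * del i (n - k.+1)%N)|
    <= C * (T n - T n.+1).

(** The limit, after division by G, of the expression compared with s T in [Teq]: the total weight
    of each y meets the limit of its own kernel. *)
Let mu := b + \sum_i Y i * c i.

Let Tdec : {homo T : m n / (m <= n)%N >-> n <= m}.
Proof.
apply: homo_leq => //; first by move=> x u z h1 h2; exact: le_trans h2 h1.
by move=> n; rewrite -subr_ge0 Ty sumr_ge0.
Qed.

Lemma ratio_cvg_ge0 (u : nat -> R) (l : R) : (forall n, 0 <= u n) ->
  (fun n => u n / G n) @ \oo --> l -> 0 <= l.
Proof.
move=> u0 ul; rewrite -(cvg_lim (@Rhausdorff R) ul) limr_ge//.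
  by apply/cvg_ex; exists l.
by apply: nearW => n; rewrite divr_ge0// ltW// tailF_gt0.
Qed.

Let mu0 : 0 <= mu.
Proof.
rewrite addr_ge0 ?(ratio_cvg_ge0 bet0 betb)// sumr_ge0// => i _.
rewrite mulr_ge0 ?(ratio_cvg_ge0 _ (@delc i))//.
rewrite -(cvg_lim (@Rhausdorff R) (@yY i)) limr_ge//.
  by apply/cvg_ex; exists (Y i).
by apply: nearW => n; rewrite sumr_ge0.
Qed.

(** The bound is taken at n + 1 because the kernel is evaluated at n - (k + 1); it then reads D G (n
    - k), the form needed for summation by parts. *)
Let del_dominated : exists2 D, 0 < D & forall i n, del i n <= D * G n.+1.
Proof.
have [D D0 hD] := long_tailed_dominated.
have bd i : exists M, 0 <= M /\ forall n, del i n / G n <= M.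
  have /cvgP/cvg_has_ub[M hM] := @delc i.
  exists M; split; last first.
    by move=> n; apply: le_trans (ler_norm _) _; apply: hM; exists n.
  by apply: le_trans (normr_ge0 (del i 0 / G 0)) _; apply: hM; exists 0%N.
have /choice[M hM] := bd.
have S0 : 0 <= \sum_i M i by rewrite sumr_ge0// => i _; case: (hM i).
exists ((1 + \sum_i M i) * D); first by rewrite mulr_gt0// ltr_wpDr.
move=> i n; rewrite -mulrA.
apply: le_trans (ler_wpM2l _ (hD n)); last by rewrite addr_ge0.
rewrite -ler_pdivrMr ?tailF_gt0//; apply: le_trans ((hM i).2 n) _.
rewrite (bigD1 i)//= addrCA lerDl addr_ge0// sumr_ge0// => j _.
by case: (hM j).
Qed.

Let conv (k n : nat) := \sum_i y k i * del i (n - k.+1)%N.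

Let conv_ge0 k n : 0 <= conv k n.
Proof. by rewrite sumr_ge0// => i _; rewrite mulr_ge0. Qed.

(** For fixed K the finitely many head terms converge by long-tailedness, and their limit tends to
    mu as K grows. Hence K is chosen before n. *)
Let head_estimate (e : R) : 0 < e -> exists K0, forall K, (K0 <= K)%N ->
  \forall n \near \oo,
    `|bet n + \sum_(0 <= k < K) conv k n - mu * G n| <= e * G n.
Proof.
move=> e0; have e20 : 0 < e / 2 by rewrite divr_gt0.
pose muK K := b + \sum_(0 <= k < K) \sum_i y k i * c i.
have muKE : muK @ \oo --> mu.
  apply: cvgD; first exact: cvg_cst.
  rewrite (_ : (fun K => _) = (fun K => \sum_i (\sum_(0 <= k < K) y k i) * c i)).
    by apply: cvgn_sum => i _; apply: cvgM (@yY i) (cvg_cst _).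
  apply/funext => K; rewrite exchange_big /=.
  by apply: eq_bigr => i _; rewrite mulr_suml.
have [N _ hN] : \forall K \near \oo, `|mu - muK K| <= e / 2.
  by move/cvgrPdist_le : muKE => /(_ _ e20).
exists N => K NK; have /= hK := hN K NK.
have hc : (fun n => (bet n + \sum_(0 <= k < K) conv k n) / G n) @ \oo --> muK K.
  rewrite (_ : (fun n => _) = (fun n => bet n / G n +
     \sum_(0 <= k < K) \sum_i y k i * (del i (n - k.+1)%N / G n))); last first.
    apply/funext => n; rewrite mulrDl; congr (_ + _).
    rewrite mulr_suml; apply: eq_bigr => k _; rewrite mulr_suml.
    by apply: eq_bigr => i _; rewrite mulrA.
  apply: cvgD => //; apply: cvgn_sum => k _; apply: cvgn_sum => i _.
  apply: cvgM; first exact: cvg_cst.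
  rewrite -(cvg_shiftn k.+1).
  rewrite (_ : (fun n => _) = (fun n => del i n / G n / (G (n + k.+1)%N / G n))).
    suff : (fun n => del i n / G n / (G (n + k.+1)%N / G n)) @ \oo --> c i / 1.
      by rewrite divr1.
    apply: cvgM (@delc i) _; apply: cvgV; first exact: oner_neq0.
    by case: hL => _; exact.
  apply/funext => n; rewrite addnK.
  have := tailF_gt0 n; have := tailF_gt0 (n + k.+1); move=> *; field.
  by rewrite !gt_eqF.
have := cvgn_ratio_bounds tailF_gt0 hc e20.
apply: filterS => n /=; have g0 := tailF_gt0 n => h.
set u := bet n + _ in h *.
have -> : u - mu * G n = (u - muK K * G n) - (mu - muK K) * G n by ring.
apply: le_trans (ler_normB _ _) _; rewrite normrM (gtr0_norm g0).
have : `|mu - muK K| * G n <= e / 2 * G n by rewrite ler_pM2r.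
lra.
Qed.


(** The convolution is cut at K and n - K. The head gives mu G n, the middle is small by
    subexponentiality, and in the top part G is at most 1, so the increments of T telescope. The
    order of quantifiers matters: C' precedes e, and the threshold for n is uniform in B, so that
    the estimate can serve to establish a bound B. *)
Let local_estimate : exists2 C', 0 <= C' & forall e, 0 < e -> exists K,
  \forall n \near \oo, forall B, 0 <= B -> (forall j, (j < n)%N -> T j <= B * G j) ->
  `|s * T n - mu * G n| <= e * (1 + B) * G n + C' * (T (n - K)%N - T n.+1).
Proof.
have [D D0 hD] := del_dominated.
exists (C + D); first by rewrite addr_ge0// ltW.
(* Three shares: in the middle part the boundary term of the summation by parts costs two of them
   and the convolution with the masses costs one. *)
move=> e e0; have eD0 : 0 < e / (3 * D) by rewrite divr_gt0// mulr_gt0.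
have [K1 hK1] := head_estimate e0.
have [K2 hK2] := subexponential_middle eD0.
have [K3 _ hK3] : \forall K \near \oo, G K <= e / (3 * D).
  have /cvgrPdist_le /(_ _ eD0) := tailF_cvg0; apply: filterS => n /=.
  by rewrite sub0r normrN ger0_norm// ltW// tailF_gt0.
pose K := (K1 + K2 + K3).+1.
have K1K : (K1 <= K)%N by rewrite /K -addnA leqW// leq_addr.
have K2K : (K2 <= K)%N by rewrite /K addnAC leqW// leq_addl.
have K3K : (K3 <= K)%N by rewrite /K leqW// leq_addl.
have K_gt0 : (0 < K)%N by [].
move: K K_gt0 K1K K2K K3K => K K_gt0 K1K K2K K3K.
exists K; have h1 := hK1 _ K1K.
have /= h3 := hK3 _ K3K.
have [N2 _ h2] := hK2 _ K2K.
have [N4 _ h4] := long_tailed_shift K (ltr1n R 2).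
near=> n => B B0 hB.
have Kn : (K + K <= n)%N by near: n; exact: nbhs_infty_ge.
have KnK : (K <= n - K)%N by rewrite leq_subRL// (leq_trans _ Kn)// leq_addr.
have h1n : `|bet n + \sum_(0 <= k < K) conv k n - mu * G n| <= e * G n.
  by near: n; exact: h1.
have h2n : \sum_(K <= j < n.+2) mass F j * G (n.+1 - j)%N <= e / (3 * D) * G n.+1.
  by apply: h2 => /=; apply: leqW; near: n; exact: nbhs_infty_ge.
have G0 k := ltW (tailF_gt0 k).
have hp k : (k < n)%N -> conv k n <= D * ((T k - T k.+1) * G (n - k)%N).
  move=> kn; rewrite Ty mulr_suml mulr_sumr ler_sum// => i _.
  rewrite mulrCA ler_wpM2l//; apply: le_trans (hD _ _) _.
  by rewrite subnSK.
have top : \sum_(n - K <= k < n) conv k n <= D * (T (n - K)%N - T n).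
  rewrite -(opprB (T n)) -(telescope_sumr T (leq_subr _ _)) -sumrN mulr_sumr.
  apply: ler_sum_nat => k /andP[_ kn]; apply: le_trans (hp _ kn) _.
  rewrite opprB ler_pM2l// ler_piMr ?tailF_le1//.
  by rewrite Ty sumr_ge0.
have mid : \sum_(K <= k < n - K) conv k n <= e * B * G n.
  apply: (@le_trans _ _ (D * \sum_(K <= k < n - K) (T k - T k.+1) * G (n - k)%N)).
    rewrite mulr_sumr; apply: ler_sum_nat => k /andP[_ kn]; apply: hp.
    by rewrite (leq_trans kn)// leq_subr.
  (* The assumed bound concerns T and not its increments; after this step only values of T occur,
     against a boundary value of G and the masses of F. *)
  have := sum_by_parts T G KnK (leq_subr K n).
  have TG0 : 0 <= T (n - K)%N * G (n.+1 - (n - K))%N by rewrite mulr_ge0.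
  set S1 := \sum_(K <= k < n - K) (T k - T k.+1) * G (n - k)%N.
  set S2 := \sum_(K <= k < n - K) _ => S12.
  have hT : T K * G (n.+1 - K)%N <= B * (e / (3 * D)) * (2 * G n).
    rewrite ler_pM//.
      apply: le_trans (hB K _) _; last by rewrite ler_wpM2l.
      by clear -Kn K_gt0; lia.
    have N4n : (N4 + K <= n)%N by near: n; exact: nbhs_infty_ge.
    apply: le_trans (h4 (n.+1 - K)%N _) _; first by rewrite /=; clear -Kn N4n; lia.
    rewrite subnK; last by clear -Kn; lia.
    by rewrite ler_pM2l// tailF_noninc.
  have hS2 : S2 <= B * (e / (3 * D) * G n.+1).
    apply: (@le_trans _ _ (B * \sum_(K <= k < n - K) G k * mass F (n.+1 - k)%N)).
      rewrite mulr_sumr; apply: ler_sum_nat => k /andP[_ kn].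
      have kn' : (k < n)%N by rewrite (leq_trans kn)// leq_subr.
      rewrite mulrA subSn ?(ltnW kn')//= /G /tailF.
      rewrite (_ : 1 - _ - _ = F (n - k).+1 - F (n - k)%N); last by ring.
      rewrite ler_wpM2r ?hB//.
      by case: hF => _ Fh _; rewrite subr_ge0 Fh.
    by rewrite ler_wpM2l// (le_trans _ h2n)// mass_reverse_sum_le.
  have Gn : G n.+1 <= G n by rewrite tailF_noninc.
  have DE : D * (e / (3 * D)) = e / 3 by field; rewrite gt_eqF.
  have : D * S1 <= D * (B * (e / (3 * D)) * (2 * G n) + B * (e / (3 * D) * G n)).
    rewrite ler_pM2l//.
    have : B * (e / (3 * D) * G n.+1) <= B * (e / (3 * D) * G n).
      by rewrite !ler_wpM2l// ltW.
    lra.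
  move/le_trans; apply.
  rewrite le_eqVlt; apply/orP; left; apply/eqP.
  transitivity (3 * (B * (D * (e / (3 * D))) * G n)); first by ring.
  by rewrite DE; field.
have m0 : 0 <= \sum_(K <= k < n - K) conv k n by rewrite sumr_ge0.
have t0 : 0 <= \sum_(n - K <= k < n) conv k n by rewrite sumr_ge0.
have dT : 0 <= T n - T n.+1 by rewrite Ty sumr_ge0.
have dT' : 0 <= T (n - K)%N - T n by rewrite subr_ge0 Tdec// leq_subr.
have CD : C * (T n - T n.+1) + D * (T (n - K)%N - T n) <=
   (C + D) * (T (n - K)%N - T n.+1).
  rewrite mulrDl lerD// ler_wpM2l//; last by rewrite lerB// Tdec.
    by rewrite lerB// Tdec// leq_subr.
  exact: ltW.
have := Teq n; rewrite -/(conv _ _).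
rewrite (eq_bigr (fun k => conv k n))//.
rewrite (big_cat_nat _ (n := K))//=; last by rewrite (leq_trans _ Kn)// leq_addr.
rewrite (big_cat_nat _ (m := K) (n := (n - K)%N))//=; last exact: leq_subr.
have e1 := mulrDr e 1 B; move: h1n CD; rewrite !ler_norml e1 mulr1 mulrDl.
move=> /andP[? ?] ? /andP[? ?]; apply/andP; split; lra.
Unshelve. all: by end_near. Qed.

(* The error term of [local_estimate] may be as large as G n at a given n, but it
   telescopes, so averaging over a long window of consecutive levels kills it. *)
Let window_estimate (e : R) : 0 < e -> exists W,
  \forall N \near \oo, forall B, 0 <= B ->
    (forall j, (j < N + W)%N -> T j <= B * G j) ->
    s * T (N + W)%N <= (mu + e * (1 + B)) * G (N + W)%N /\
    (mu - e * (1 + B)) * G N <= s * T N.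
Proof.
move=> e0; have [C' C'0 hC'] := local_estimate.
pose e' := e / 8; have e'0 : 0 < e' by rewrite divr_gt0.
have [K hK] := hC' _ e'0.
(* The lag sum over a window is at most (K + 1) T, whatever its length; this W brings its average
   below a share e'. *)
have [W [W0 hW]] : exists W, (0 < W)%N /\ C' * K.+1%:R <= e' * W%:R.
  exists (Num.truncn (C' * K.+1%:R / e')).+1; split => //.
  by rewrite [leRHS]mulrC -ler_pdivrMr// ltW// truncnS_gt.
exists W.
(* The relative loss in passing between G (N - K), G N and G (N + W): eta at most 1 keeps the factor
   below 2, and the other bound makes eta mu at most e / 2. *)
pose eta := Num.min 1 (e / (2 * (mu + 1))).
have eta0 : 0 < eta by rewrite lt_min ltr01 divr_gt0// mulr_gt0// ltr_wpDl.
have eta1 : eta <= 1 by rewrite ge_min lexx.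
have etamu : eta * mu <= e / 2.
  apply: (@le_trans _ _ (e / (2 * (mu + 1)) * mu)).
    by rewrite ler_wpM2r// ge_min lexx orbT.
  have -> : e / (2 * (mu + 1)) * mu = e / 2 * (mu / (mu + 1)).
    by field; rewrite gt_eqF// ltr_wpDl.
  rewrite ler_piMr ?divr_ge0 ?(ltW e0)//.
  by rewrite ler_pdivrMr ?mul1r ?lerDl// ltr_wpDl.
have eta1' : 1 < 1 + eta by rewrite ltrDl.
have [N1 _ h1] := hK.
have [N2 _ h2] := long_tailed_shift W eta1'.
have [N3 _ h3] := long_tailed_shift (K + W) eta1'.
exists (N1 + N2 + N3 + K)%N => // N /= hN B B0 hB.
have GN : G N <= (1 + eta) * G (N + W)%N by apply: h2 => /=; clear -hN; lia.
have GNK : G (N - K)%N <= (1 + eta) * G (N + W)%N.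
  have -> : (N + W = N - K + (K + W))%N by clear -hN; lia.
  by apply: h3 => /=; clear -hN; lia.
have G0 k := ltW (tailF_gt0 k).
have sumE : `|\sum_(0 <= i < W) (s * T (N + i)%N - mu * G (N + i)%N)| <=
    W%:R * (e' * (1 + B) * G N) + W%:R * (e' * B * G (N - K)%N).
  apply: (@le_trans _ _ (\sum_(0 <= i < W) (e' * (1 + B) * G N +
      C' * (T (N - K + i)%N - T (N - K + i + K.+1)%N)))).
    apply: le_trans (ler_norm_sum _ _ _) _; apply: ler_sum_nat => i /andP[_ iW].
    have := @h1 (N + i)%N; rewrite /= => /(_ _ B B0).
    rewrite (_ : (N + i - K = N - K + i)%N); last by clear -hN; lia.
    rewrite (_ : ((N + i).+1 = N - K + i + K.+1)%N); last by clear -hN; lia.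
    move=> /(_ _ _)/le_trans; apply.
    - by clear -hN; lia.
    - by move=> j jN; apply: hB; clear -jN iW; lia.
    - rewrite lerD2r ler_wpM2l ?tailF_noninc ?leq_addr//.
      by rewrite mulr_ge0 ?(ltW e'0)// addr_ge0.
  rewrite big_split/= sumr_const_nat subn0 -[X in X + _]mulr_natl lerD2l.
  rewrite -mulr_sumr.
  apply: le_trans (ler_wpM2l C'0 (sum_lag_le (N - K) K W Tdec T0)) _.
  rewrite [leLHS]mulrA.
  apply: (@le_trans _ _ (e' * W%:R * (B * G (N - K)%N))).
    rewrite ler_pM//; first exact: mulr_ge0.
    by apply: hB; clear -hN W0; lia.
  by rewrite le_eqVlt; apply/orP; left; apply/eqP; ring.
have W0' : 0 < W%:R :> R by rewrite ltr0n.
have e'B : 0 <= e' * B by rewrite mulr_ge0// ltW.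
have e'B1 : 0 <= e' * (1 + B) by rewrite mulr_ge0 ?addr_ge0// ltW.
have GW : G (N + W)%N <= G N by rewrite tailF_noninc// leq_addr.
have g0 := G0 (N + W)%N.
have constW (r : R) : \sum_(0 <= i < W) r = W%:R * r.
  by rewrite sumr_const_nat subn0 mulr_natl.
(* As T is nonincreasing, its average over the window lies above T (N + W) and below T N. This gives
   the upper estimate at the right end and the lower one at the left end. *)
move: sumE; rewrite ler_norml sumrB -mulrDr => /andP[lo up]; split.
- have hT : W%:R * (s * T (N + W)%N) <= \sum_(0 <= i < W) s * T (N + i)%N.
    rewrite -constW; apply: ler_sum_nat => i /andP[_ iW].
    by rewrite ler_wpM2l ?(ltW s0)// Tdec// leq_add2l ltnW.
  have hG : \sum_(0 <= i < W) mu * G (N + i)%N <= W%:R * (mu * G N).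
    rewrite -constW; apply: ler_sum_nat => i _.
    by rewrite ler_wpM2l// tailF_noninc// leq_addr.
  have h : s * T (N + W)%N <= mu * G N + (e' * (1 + B) * G N + e' * B * G (N - K)%N).
    by rewrite -(ler_pM2l W0'); lra.
  apply: le_trans h _.
  apply: (@le_trans _ _ (mu * ((1 + eta) * G (N + W)%N) +
     (e' * (1 + B) * ((1 + eta) * G (N + W)%N) + e' * B * ((1 + eta) * G (N + W)%N)))).
    by rewrite !lerD// ler_wpM2l.
  rewrite !mulrA -!mulrDl ler_wpM2r//.
  have hh : e' * (1 + B) * eta <= e' * (1 + B) by rewrite ler_piMr.
  have hh2 : e' * B * eta <= e' * B by rewrite ler_piMr.
  have eB : 0 <= e * B by rewrite mulr_ge0// ltW.
  rewrite /e' in e'B hh hh2 *; lra.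
- have hT : \sum_(0 <= i < W) s * T (N + i)%N <= W%:R * (s * T N).
    rewrite -constW; apply: ler_sum_nat => i /andP[_ iW].
    by rewrite ler_wpM2l ?(ltW s0)// Tdec// leq_addr.
  have hG : W%:R * (mu * G (N + W)%N) <= \sum_(0 <= i < W) mu * G (N + i)%N.
    rewrite -constW; apply: ler_sum_nat => i /andP[_ iW].
    by rewrite ler_wpM2l// tailF_noninc// leq_add2l ltnW.
  have h : mu * G (N + W)%N <= s * T N + (e' * (1 + B) * G N + e' * B * G (N - K)%N).
    by rewrite -(ler_pM2l W0'); lra.
  have h4 : G (N - K)%N <= 2 * G N.
    apply: le_trans GNK _.
    apply: (@le_trans _ _ (2 * G (N + W)%N)); last by rewrite ler_pM2l.
    by rewrite ler_wpM2r// -[2]/(1 + 1) lerD2l.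
  have h5 : e' * B * G (N - K)%N <= e' * B * (2 * G N) by rewrite ler_wpM2l.
  have h6 : mu * G N <= mu * G (N + W)%N + e / 2 * G N.
    apply: (@le_trans _ _ (mu * ((1 + eta) * G (N + W)%N))); first by rewrite ler_wpM2l.
    rewrite (_ : mu * _ = mu * G (N + W)%N + eta * mu * G (N + W)%N); last by ring.
    by rewrite lerD2l ler_pM// mulr_ge0// ltW.
  have eB : 0 <= e * B * G N by rewrite !mulr_ge0// ltW.
  have eG : 0 <= e * G N by rewrite !mulr_ge0// ltW.
  rewrite /e' in h h5 *; lra.
Qed.

(** Strong induction: the upper window estimate for T m uses the bound only at indices below m and
    returns it with the same constant. *)
Let tail_dominated : exists2 B, 0 <= B & forall j, T j <= B * G j.
Proof.
have e0 : 0 < s / 2 by rewrite divr_gt0.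
have [W [N0 _ hN0]] := window_estimate e0.
pose m0 := (N0 + W)%N.
(* The first summand makes mu + (s / 2) (1 + B) at most s B, which closes the induction; the finite
   sum covers the indices below m0. *)
pose B := 2 * (mu + s / 2) / s + \sum_(0 <= k < m0) T k / G k.
have TG k : 0 <= T k / G k by rewrite divr_ge0// ltW// tailF_gt0.
have S0 : 0 <= \sum_(0 <= k < m0) T k / G k by rewrite sumr_ge0.
have M0 : 0 <= 2 * (mu + s / 2) / s by rewrite divr_ge0 ?(ltW s0)// mulr_ge0// addr_ge0// ltW.
have B0 : 0 <= B by rewrite addr_ge0.
exists B => //; elim/ltn_ind => m IH.
have [mm0|m0m] := ltnP m m0.
  rewrite -ler_pdivrMr ?tailF_gt0// /B (bigD1_seq m)/= ?mem_index_iota ?iota_uniq//.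
  by rewrite addrCA lerDl addr_ge0// sumr_ge0.
have := hN0 (m - W)%N; rewrite /= subnK; last by clear -m0m; lia.
move=> /(_ _ B B0 IH)[|]; first by rewrite /m0 in m0m; clear -m0m; lia.
move=> h _; rewrite -(ler_pM2l s0); apply: le_trans h _; rewrite mulrA.
rewrite ler_wpM2r ?(ltW (tailF_gt0 _))//.
suff : 2 * (mu + s / 2) <= s * B by lra.
rewrite /B [leRHS]mulrDr.
have -> : s * (2 * (mu + s / 2) / s) = 2 * (mu + s / 2) by field; rewrite gt_eqF.
by rewrite lerDl mulr_ge0// ltW.
Qed.

(** With B now fixed, the factor 1 + B can be absorbed into e. The lower bound comes from the window
    starting at n, the upper one from the window ending there. *)
Lemma renewal_tail_cvg : (fun n => T n / G n) @ \oo --> mu / s.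
Proof.
have [B B0 hB] := tail_dominated.
apply/cvgrPdist_le => e e0.
have e'0 : 0 < s * e / (1 + B) by rewrite divr_gt0 ?mulr_gt0// ltr_pwDl.
have [W [N0 _ hN0]] := window_estimate e'0.
exists (N0 + W)%N => // n /= nN.
have eE : s * e / (1 + B) * (1 + B) = s * e.
  by rewrite divfK// gt_eqF// ltr_pwDl.
have g0 := tailF_gt0 n.
have [_ lo] := hN0 n ltac:(clear -nN; rewrite /=; lia) B B0 (fun j _ => hB j).
have := hN0 (n - W)%N ltac:(clear -nN; rewrite /=; lia) B B0 (fun j _ => hB j).
rewrite subnK; last by clear -nN; lia.
move=> [up _]; rewrite eE in lo up.
rewrite distrC ler_distl; apply/andP; split.
  rewrite -(ler_pM2l s0) mulrBr mulrCA divff ?gt_eqF// mulr1 mulrA.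
  by rewrite ler_pdivlMr.
rewrite -(ler_pM2l s0) mulrDr [_ * (mu / s)]mulrCA divff ?gt_eqF// mulr1 mulrA.
by rewrite ler_pdivrMr.
Qed.

End Renewal.
End SubexponentialTail.
End TailAsymptotics.

(** * Means, hitting probabilities and perturbation of stationary vectors *)

Section Means.
Variables (R : realType) (T : choiceType).
Implicit Types (z f g : T -> R) (p : T -> T -> R).

Lemma esum_ge_term (a : T -> \bar R) t : (forall u, 0 <= a u)%E ->
  (a t <= \esum_(u in [set: T]) a u)%E.
Proof.
move=> a0; apply: esum_ge; exists [set t]; last by rewrite fsbig_set1.
by split => //; exact: finite_set1.
Qed.

Lemma esum_mul_le (c : R) (a : T -> \bar R) : 0 <= c -> (forall u, 0 <= a u)%E ->
  (\esum_(t in [set: T]) (c%:E * a t) <= c%:E * \esum_(t in [set: T]) a t)%E.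
Proof.
move=> c0 a0; apply: ge_ereal_sup => _ [X [finX _] <-].
rewrite -ge0_mule_fsumr// lee_wpmul2l ?lee_fin//.
by apply: ereal_sup_ubound; exists X.
Qed.

Lemma esum_mul (c : R) (a : T -> \bar R) : 0 <= c -> (forall u, 0 <= a u)%E ->
  (\esum_(t in [set: T]) (c%:E * a t) = c%:E * \esum_(t in [set: T]) a t)%E.
Proof.
rewrite le_eqVlt => /predU1P[<- a0|c0 a0].
  by rewrite mul0e esum1// => t _; rewrite mul0e.
apply/eqP; rewrite eq_le esum_mul_le ?(ltW c0)//=.
have ci0 : 0 <= c^-1 by rewrite invr_ge0 ltW.
have -> : (\esum_(t in [set: T]) a t =
    \esum_(t in [set: T]) (c^-1%:E * (c%:E * a t)))%E.
  by apply: eq_esum => t _; rewrite muleA -EFinM mulVf ?gt_eqF// mul1e.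
have ca0 t : (0 <= c%:E * a t)%E by rewrite mule_ge0// lee_fin ltW.
have c0' : (0 <= c%:E)%E by rewrite lee_fin ltW.
apply: le_trans (lee_wpmul2l c0' (esum_mul_le ci0 ca0)) _.
by rewrite muleA -EFinM divff ?gt_eqF// mul1e.
Qed.

Definition probability_vector z : Prop :=
  (forall t, 0 <= z t) /\ \esum_(t in [set: T]) (z t)%:E = 1%E.

(** A real number by way of [fine], which would send an infinite sum to 0; [meanE] shows that this
    does not happen for bounded nonnegative f. *)
Definition mean z f : R := fine (\esum_(t in [set: T]) (z t * f t)%:E).

Lemma meanE z f (M : R) : probability_vector z -> (forall t, 0 <= f t <= M) ->
  (mean z f)%:E = \esum_(t in [set: T]) (z t * f t)%:E.
Proof.
move=> [z0 z1] fM; rewrite fineK// ge0_fin_numE; last first.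
  by apply: esum_ge0 => t _; rewrite lee_fin mulr_ge0//; case/andP: (fM t).
have M0 : 0 <= Num.max M 0 by rewrite le_max lexx orbT.
apply: (@le_lt_trans _ _ (\esum_(t in [set: T]) ((Num.max M 0)%:E * (z t)%:E))%E).
  apply: le_esum => t _; rewrite -EFinM lee_fin mulrC ler_wpM2r//.
  by case/andP: (fM t) => _; rewrite le_max => ->.
by rewrite esum_mul// z1 mule1 ltry.
Qed.

Lemma mean_ge0 z f : (forall t, 0 <= z t) -> (forall t, 0 <= f t) -> 0 <= mean z f.
Proof.
by move=> z0 f0; rewrite fine_ge0// esum_ge0// => t _; rewrite lee_fin mulr_ge0.
Qed.

Lemma ler_mean z f g (M : R) : probability_vector z -> (forall t, 0 <= f t) ->
  (forall t, f t <= g t <= M) -> mean z f <= mean z g.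
Proof.
move=> pz f0 fg; rewrite -lee_fin !(@meanE _ _ M)//.
- apply: le_esum => t _; rewrite lee_fin ler_wpM2l ?pz.1//.
  by case/andP: (fg t).
- by move=> t; case/andP: (fg t) => /(le_trans (f0 t)) ->.
- by move=> t; case/andP: (fg t) => /le_trans h /h; rewrite f0.
Qed.

Lemma meanD z f g (M : R) : probability_vector z -> (forall t, 0 <= f t <= M) ->
  (forall t, 0 <= g t <= M) -> mean z (fun t => f t + g t) = mean z f + mean z g.
Proof.
move=> pz fM gM; apply: EFin_inj; rewrite EFinD (@meanE _ _ (M + M))//; last first.
  move=> t; case/andP: (fM t) (gM t) => ? ? /andP[? ?].
  by rewrite addr_ge0//= lerD.
rewrite !(@meanE _ _ M)// -esumD; first by apply: eq_esum => t _; rewrite mulrDr EFinD.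
- by move=> t _; rewrite lee_fin mulr_ge0 ?pz.1//; case/andP: (fM t).
- by move=> t _; rewrite lee_fin mulr_ge0 ?pz.1//; case/andP: (gM t).
Qed.

Lemma mean_cst z (c : R) : probability_vector z -> 0 <= c -> mean z (fun=> c) = c.
Proof.
move=> [z0 z1] c0; apply: EFin_inj; rewrite (@meanE _ _ c)//; last by rewrite c0 lexx.
under eq_esum => t _ do rewrite mulrC EFinM.
by rewrite esum_mul// z1 mule1.
Qed.

Lemma mean_at z s (c : R) : probability_vector z -> 0 <= c ->
  mean z (fun t => if t == s then c else 0) = z s * c.
Proof.
move=> [z0 z1] c0; apply: EFin_inj; rewrite (@meanE _ _ c)//; last first.
  by move=> t; case: ifP; rewrite ?lexx c0.
rewrite -(@esum_set1 R T s (fun t => (z t * c)%:E)) ?lee_fin ?mulr_ge0//.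
rewrite [RHS]esum_mkcond; apply: eq_esum => t _.
by rewrite in_set1; case: eqP => // _; rewrite mulr0.
Qed.

Lemma mean_le1 z f : probability_vector z -> (forall t, 0 <= f t <= 1) ->
  0 <= mean z f <= 1.
Proof.
move=> pz f1; have [z0 _] := pz.
rewrite mean_ge0//=; last by move=> t; case/andP: (f1 t).
rewrite -[leRHS](@mean_cst z 1)//.
apply: (@ler_mean _ _ _ 1) => // t; first by case/andP: (f1 t).
by case/andP: (f1 t) => _ ->; rewrite lexx.
Qed.

Lemma mean_eq0 z f t : probability_vector z -> (forall t, 0 <= f t <= 1) ->
  mean z f = 0 -> 0 < z t -> f t = 0.
Proof.
move=> pz f1 m0 zt; have f0 u : 0 <= f u by case/andP: (f1 u).
have := @esum_ge_term (fun t => (z t * f t)%:E) t.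
rewrite -(@meanE _ _ 1)// m0 lee_fin => /(_ _) h.
apply/eqP; rewrite eq_le f0 andbT -(ler_pM2l zt) mulr0; apply: h => u.
by rewrite lee_fin mulr_ge0 ?pz.1.
Qed.

Lemma probability_vector_stationary p z : stationary p z -> probability_vector z.
Proof. by case. Qed.

Lemma probability_vector_stochastic p s : stochastic p -> probability_vector (p s).
Proof. by case=> p0 p1; split. Qed.

Lemma irreducible_closed p (P : T -> Prop) a : irreducible_mat p ->
  (forall s t, P s -> 0 < p s t -> P t) -> P a -> forall t, P t.
Proof.
move=> pI cl Pa t; have [q [+ <-]] := pI a t.
elim: q a Pa => //= u q IH a Pa /andP[pau]; exact: IH (cl _ _ Pa pau).
Qed.

(** Total mass 1 provides one positive state, and x t >= x s p s t carries positivity along every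
    path. *)
Lemma stationary_gt0 p z : (forall s t, 0 <= p s t) -> irreducible_mat p ->
  stationary p z -> forall s, 0 < z s.
Proof.
move=> p0 pI [z0 z1 zp].
have [a za] : exists a, 0 < z a.
  apply/not_existsP => h; have : \esum_(s in [set: T]) (z s)%:E = 0%E :> \bar R.
    apply: esum1 => s _; congr EFin; apply/eqP; rewrite eq_le z0 andbT.
    by rewrite leNgt; apply/negP/h.
  by rewrite z1 => /eqP; rewrite onee_eq0.
apply: (irreducible_closed pI _ za) => s t zs pst.
apply: (@lt_le_trans _ _ (z s * p s t)); first by rewrite mulr_gt0.
rewrite -lee_fin -zp; apply: (@esum_ge_term (fun s => (z s * p s t)%:E)) => u.
by rewrite lee_fin mulr_ge0.
Qed.

(** Tonelli: all terms are nonnegative, so the sums over s and t may be exchanged in the extended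
    reals, and summing over s first yields z t. *)
Lemma stationary_esum p z f : (forall s t, 0 <= p s t) -> stationary p z ->
  (forall t, 0 <= f t) ->
  (\esum_(s in [set: T]) ((z s)%:E * \esum_(t in [set: T]) (p s t * f t)%:E) =
   \esum_(t in [set: T]) (z t * f t)%:E)%E.
Proof.
move=> p0 [z0 z1 zp] f0.
under eq_esum => s _.
  rewrite -esum_mul//; last by move=> t; rewrite lee_fin mulr_ge0.
  over.
rewrite esum_esum; last by move=> *; rewrite -EFinM lee_fin !mulr_ge0.
have sw : set_bij ([set: T] `*`` (fun=> [set: T])) ([set: T] `*`` (fun=> [set: T]))
   (fun k : T * T => (k.2, k.1)).
  split => //; first by move=> [u v] [u' v'] _ _ [-> ->].
  by move=> [u v] _; exists (v, u).
rewrite (@reindex_esum _ _ _ _ _ _ _ sw)/=.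
rewrite -(@esum_esum _ _ _ _ (fun=> [set: T])
  (fun t s => ((z s)%:E * (p s t * f t)%:E)%E)); last first.
  by move=> *; rewrite -EFinM lee_fin !mulr_ge0.
apply: eq_esum => t _; rewrite EFinM -zp muleC -esum_mul//; last first.
  by move=> u; rewrite lee_fin mulr_ge0.
by apply: eq_esum => s _; rewrite -!EFinM; congr EFin; ring.
Qed.

Lemma mean_stationary p z f : stochastic p -> stationary p z ->
  (forall t, 0 <= f t <= 1) -> mean z (fun s => mean (p s) f) = mean z f.
Proof.
move=> sp zp f1; have pz := probability_vector_stationary zp.
have pp s := probability_vector_stochastic s sp.
apply: EFin_inj; rewrite !(@meanE _ _ 1)//; last by move=> s; exact: mean_le1.
have f0 t : 0 <= f t by case/andP: (f1 t).
rewrite -(stationary_esum sp.1 zp f0).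
by apply: eq_esum => s _; rewrite EFinM (@meanE _ _ 1).
Qed.

End Means.

(** * The probability of hitting one state before another *)

Section HittingProbability.
Variables (R : realType) (T : choiceType) (p : T -> T -> R).
Hypothesis sp : stochastic p.
Variables s0 a : T.
Hypothesis s0a : s0 != a.

Let pp s := probability_vector_stochastic s sp.

(** Superharmonic off the two states, with the prescribed boundary values. The pointwise infimum of
    these functions plays the role of the hitting probability, without any construction of
    trajectories. *)
Let supersolution (v : T -> R) : Prop :=
  [/\ forall t, 0 <= v t <= 1, v s0 = 1, v a = 0 &
      forall s, s != s0 -> s != a -> mean (p s) v <= v s].

Let hit s : R := inf [set v s | v in supersolution].

(** A member of the family, so that the infimum is taken over a nonempty set. *)
Let super1 : supersolution (fun t => if t == a then 0 else 1).
Proof.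
split; rewrite ?eqxx ?(negbTE s0a)//.
  by move=> t; case: ifP; rewrite ?lexx ler01.
move=> s _ /negbTE ->; suff /andP[] : 0 <= mean (p s) (fun t => if t == a then 0 else 1) <= 1 by [].
by apply: mean_le1 => // t; case: ifP; rewrite ?lexx ler01.
Qed.

Let hit_le v s : supersolution v -> hit s <= v s.
Proof.
move=> sv; apply: ge_inf; last by exists v.
by exists 0 => _ [u [u1 _ _ _] <-]; case/andP: (u1 s).
Qed.

Let le_hit r s : (forall v, supersolution v -> r <= v s) -> r <= hit s.
Proof.
move=> h; apply: lb_le_inf; last by move=> _ [v sv <-]; exact: h.
by exists (if s == a then 0 else 1); exists (fun t => if t == a then 0 else 1).
Qed.

Let super_hit : supersolution hit.
Proof.
have h01 t : 0 <= hit t <= 1.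
  apply/andP; split; first by apply: le_hit => v [v1 _ _ _]; case/andP: (v1 t).
  by apply: le_trans (hit_le t super1) _; case: ifP.
split => //.
- apply/eqP; rewrite eq_le; case/andP: (h01 s0) => _ -> /=.
  by apply: le_hit => v [_ -> _ _].
- apply/eqP; rewrite eq_le; case/andP: (h01 a) => -> _; rewrite andbT.
  by apply: le_trans (hit_le a super1) _; rewrite eqxx.
- move=> s ss0 sa; apply: le_hit => v sv; have [v1 _ _ /(_ s ss0 sa)] := sv.
  apply: le_trans; apply: (@ler_mean _ _ _ _ _ 1) => // t.
    by case/andP: (h01 t).
  by rewrite hit_le//=; case/andP: (v1 t).
Qed.

(* The least supersolution is harmonic: replacing it by its mean off the two
   prescribed points yields a smaller supersolution. *)
Lemma hitting_probability : exists h : T -> R,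
  [/\ forall t, 0 <= h t <= 1, h s0 = 1, h a = 0 &
      forall s, s != s0 -> s != a -> mean (p s) h = h s].
Proof.
have [h1 hs ha hm] := super_hit.
exists hit; split => // s ss0 sa; apply/eqP; rewrite eq_le hm//=.
pose h' t := if (t == s0) || (t == a) then hit t else mean (p t) hit.
have h'h t : h' t <= hit t.
  by rewrite /h'; case: ifPn => // /norP[ts0 ta]; exact: hm.
have h'1 t : 0 <= h' t <= 1.
  by rewrite /h'; case: ifPn => // _; exact: mean_le1.
suff sh' : supersolution h'.
  by apply: le_trans (hit_le s sh') _; rewrite /h' (negbTE ss0) (negbTE sa).
split => //; rewrite /h' ?eqxx ?orbT//.
move=> t ts0 ta; rewrite (negbTE ts0) (negbTE ta)/=.
apply: (@ler_mean _ _ _ _ _ 1) => // u; first by case/andP: (h'1 u).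
by rewrite h'h; case/andP: (h1 u).
Qed.

End HittingProbability.

(** * Sensitivity of stationary ratios to a perturbation of the matrix *)

Section Perturbation.
Variables (R : realType) (T : choiceType) (p : T -> T -> R) (x : T -> R).
Hypothesis sp : stochastic p.
Hypothesis pI : irreducible_mat p.
Hypothesis xp : stationary p x.

(* With h the probability of hitting s0 before a, stationarity of x says
   x a * P h(a) = x s0 * (1 - P h(s0)); for x' this holds up to tau. *)
Lemma stationary_ratio_perturbation (s0 a : T) : exists2 C : R, 0 <= C &
  forall (p' : T -> T -> R) (x' : T -> R) (tau : R),
  (forall s t, 0 <= p' s t) -> stationary p' x' -> 0 <= tau ->
  (forall (f : T -> R) s, (forall t, 0 <= f t <= 1) ->
     (\esum_(t in [set: T]) (p' s t * f t)%:E <= (mean (p s) f + tau)%:E)%E) ->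
  `|x' s0 - x' a * (x s0 / x a)| <= C * tau.
Proof.
have x0 := stationary_gt0 sp.1 pI xp.
have [->|s0a] := eqVneq s0 a.
  exists 0 => // p' x' tau _ _ _ _.
  by rewrite divff ?gt_eqF// mulr1 subrr normr0 mul0r.
have [h [h1 hs ha hm]] := hitting_probability sp s0a.
have pp s := probability_vector_stochastic s sp.
have E1 s : 0 <= mean (p s) h <= 1 by exact: mean_le1.
pose q := mean (p a) h; pose r := mean (p s0) h.
have [q0 q1] := andP (E1 a); have [r0 r1] := andP (E1 s0).
(* Pointwise h + q 1_a = P h + (1 - r) 1_s0, since h is harmonic off s0 and a, with h s0 = 1 and h a
   = 0. Keeping every term nonnegative lets the means be added. *)
have key z : probability_vector z ->
    mean z h + z a * q = mean z (fun s => mean (p s) h) + z s0 * (1 - r).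
  move=> pz; have r1' : 0 <= 1 - r by rewrite subr_ge0.
  rewrite -(mean_at a pz q0) -(mean_at s0 pz r1').
  rewrite -(@meanD _ _ _ _ _ 1)//; last first.
    by move=> t; case: ifP; rewrite ?lexx ?ler01 ?q0.
  rewrite -(@meanD _ _ _ _ _ 1)//; last first.
    by move=> t; case: ifP; rewrite ?lexx ?ler01 ?r1'//= gerBl.
  congr mean; apply/funext => t; case: (eqVneq t s0) => [->|ts0].
    by rewrite (negbTE s0a) hs addr0 addrC subrK.
  case: (eqVneq t a) => [->|ta]; first by rewrite ha add0r addr0.
  by rewrite !addr0 hm.
have bal : x a * q = x s0 * (1 - r).
  have := key _ (probability_vector_stationary xp).
  by rewrite mean_stationary// => /addrI.
(* If r were 1, the balance would force q = 0; the zero set of h would then be closed under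
   transitions and contain a, hence also s0, where h is 1. *)
have r_lt1 : 0 < 1 - r.
  rewrite lt_neqAle subr_ge0 r1 andbT eq_sym; apply/eqP => r10.
  have qq0 : q = 0.
    by move: bal; rewrite r10 mulr0 => /eqP; rewrite mulf_eq0 gt_eqF//= => /eqP.
  suff : h s0 = 0 by rewrite hs => /eqP; rewrite oner_eq0.
  apply: (irreducible_closed (P := fun s => h s = 0) pI _ ha) => s t hs0 pst.
  apply: (mean_eq0 (pp s) h1 _ pst).
  have [->//|sa] := eqVneq s a.
  have [ss0|ss0] := eqVneq s s0; last by rewrite hm.
  by move: hs0; rewrite ss0 hs => /eqP; rewrite oner_eq0.
exists (1 - r)^-1; first by rewrite invr_ge0 ltW.
move=> p' x' tau p'0 xp' tau0 hp'.
have px' := probability_vector_stationary xp'.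
have upper f : (forall t, 0 <= f t <= 1) ->
    mean x' f <= mean x' (fun s => mean (p s) f) + tau.
  move=> f1; have f0 t : 0 <= f t by case/andP: (f1 t).
  have m1 s : 0 <= mean (p s) f <= 1 by exact: mean_le1.
  have [m10 m11] : (forall s, 0 <= mean (p s) f) /\ (forall s, mean (p s) f <= 1).
    by split => s; case/andP: (m1 s).
  rewrite -[X in _ + X](mean_cst px' tau0) -(@meanD _ _ _ _ _ (1 + tau))//; last 2 first.
  - by move=> s; rewrite m10/= ler_wpDr.
  - by move=> s; rewrite tau0/= ler_wpDl.
  rewrite -lee_fin (@meanE _ _ _ _ 1)// (@meanE _ _ _ _ (1 + tau))//; last first.
    by move=> s; rewrite addr_ge0//= lerD2r.
  rewrite -(stationary_esum p'0 xp' f0).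
  apply: le_esum => s _; rewrite EFinM lee_wpmul2l ?lee_fin ?px'.1//.
  exact: hp'.
have up1 := upper _ h1.
(* The comparison of p' with p is one-sided; applied to 1 - h as well, it gives the opposite
   inequality for h. *)
have h1' t : 0 <= 1 - h t <= 1.
  by case/andP: (h1 t) => ? ?; rewrite subr_ge0 gerBl; apply/andP.
have compl z : probability_vector z -> mean z (fun t => 1 - h t) = 1 - mean z h.
  move=> pz; apply/eqP; rewrite eq_sym subr_eq -(@meanD _ _ _ _ _ 1)//.
  under eq_fun do rewrite subrK.
  by rewrite mean_cst.
have up2 := upper _ h1'.
rewrite compl// in up2.
have := key _ px'; move: up2.
have -> : mean x' (fun s => mean (p s) (fun t => 1 - h t)) =
    1 - mean x' (fun s => mean (p s) h).
  under eq_fun do rewrite compl//.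
  apply/eqP; rewrite eq_sym subr_eq -(@meanD _ _ _ _ _ 1)//; last first.
    by move=> s; case/andP: (E1 s) => ? ?; rewrite subr_ge0 gerBl; apply/andP.
  under eq_fun do rewrite subrK.
  by rewrite mean_cst.
move=> up2 kk.
have -> : x s0 / x a = q / (1 - r).
  have -> : q = x s0 * (1 - r) / x a by rewrite -bal mulrAC divff ?mul1r// gt_eqF.
  by rewrite mulrAC mulfK// gt_eqF.
have -> : x' s0 - x' a * (q / (1 - r)) = (1 - r)^-1 * (x' s0 * (1 - r) - x' a * q).
  by field; rewrite gt_eqF.
rewrite normrM (gtr0_norm (_ : 0 < _^-1)) ?invr_gt0// ler_pM2l ?invr_gt0//.
by rewrite ler_norml; apply/andP; split; lra.
Qed.

End Perturbation.

(** * Level balance and crossing identities *)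

Section RealSums.
Variable R : realType.
Implicit Types a d p : nat -> R.

Lemma cvgn_sum0 (I : Type) (r : seq I) (P : pred I) (f : I -> nat -> R) :
  (forall i, P i -> f i @ \oo --> (0 : R)) ->
  (fun n => \sum_(i <- r | P i) f i n) @ \oo --> (0 : R).
Proof. by move=> /cvgn_sum - /(_ r); rewrite big1. Qed.

Lemma cvgn_mull0 (c : R) (u : nat -> R) : u @ \oo --> (0 : R) ->
  (fun n => c * u n) @ \oo --> (0 : R).
Proof. by move=> /(cvgM (cvg_cst c)); rewrite mulr0. Qed.

Lemma cvgn_add0 (u v : nat -> R) : u @ \oo --> (0 : R) -> v @ \oo --> (0 : R) ->
  (fun n => u n + v n) @ \oo --> (0 : R).
Proof. by move=> u0 /(cvgD u0); rewrite addr0. Qed.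

Lemma cvgn_sub0 (u v : nat -> R) : u @ \oo --> (0 : R) -> v @ \oo --> (0 : R) ->
  (fun n => u n - v n) @ \oo --> (0 : R).
Proof. by move=> u0 /(cvgB u0); rewrite subr0. Qed.

Definition tsum a (k : nat) : R := limn (fun K => \sum_(k <= l < K) a l).

Lemma tsum_cvg a k : cvgn (series a) ->
  (fun K => \sum_(k <= l < K) a l) @ \oo --> tsum a k.
Proof. by rewrite -(is_cvg_series_restrict k). Qed.

Arguments tsum_cvg [a] k _.

Lemma tsumS a k : cvgn (series a) -> tsum a k = a k + tsum a k.+1.
Proof.
move=> ca; apply/esym; apply: (@cvg_unique _ (@Rhausdorff R)
   ((fun K => \sum_(k <= l < K) a l) @ \oo)); last exact: tsum_cvg.
suff : (fun K => \sum_(k <= l < K + k.+1) a l) @ \oo --> a k + tsum a k.+1.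
  by rewrite (cvg_shiftn k.+1 (fun K => \sum_(k <= l < K) a l)).
under eq_fun do rewrite big_ltn ?leq_addl//.
apply: cvgD; first exact: cvg_cst.
rewrite (cvg_shiftn k.+1 (fun K => \sum_(k.+1 <= l < K) a l)).
exact: tsum_cvg.
Qed.

Lemma tsum_cvg0 a : cvgn (series a) -> tsum a @ \oo --> (0 : R).
Proof.
move=> ca; have aE k : tsum a k = tsum a 0 - series a k.
  elim: k => [|k IH]; first by rewrite /series/= big_geq// subr0.
  by have := tsumS k ca; rewrite seriesSr IH; lra.
rewrite (funext aE) -(subrr (tsum a 0)); apply: cvgB; first exact: cvg_cst.
exact: tsum_cvg.
Qed.

Lemma tsum_ge0 a k : (forall l, 0 <= a l) -> cvgn (series a) -> 0 <= tsum a k.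
Proof.
move=> a0 ca; apply: limr_ge; first by apply/cvg_ex; exists (tsum a k); exact: tsum_cvg.
by apply: nearW => n; rewrite sumr_ge0.
Qed.

(** Summation by parts: each a k is counted k times, up to the remainder K times the tail after K,
    which is dominated by the tail of the convergent series of k a k. *)
Lemma tsum_mean a : (forall l, 0 <= a l) -> cvgn (series a) ->
  cvgn (series (fun k => k%:R * a k)) ->
  series (fun n => tsum a n.+1) @ \oo --> tsum (fun k => k%:R * a k) 0.
Proof.
move=> a0 ca cka.
have E K : series (fun n => tsum a n.+1) K =
    series (fun k => k%:R * a k) K.+1 + K%:R * tsum a K.+1.
  elim: K => [|K IH].
    by rewrite /series/= big_geq// big_nat1 !mul0r addr0.
  rewrite seriesSr IH [in RHS]seriesSr.
  rewrite [in LHS](tsumS K.+1 ca) -natr1; ring.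
rewrite (funext E) -[X in _ --> X]addr0; apply: cvgD.
  have := tsum_cvg 0 cka; rewrite -(cvg_shiftS (series (fun k => k%:R * a k))).
  by [].
have up : (fun K => tsum (fun k => k%:R * a k) K.+1) @ \oo --> (0 : R).
  by have := tsum_cvg0 cka; rewrite -cvg_shiftS.
apply: (squeeze_cvgr _ (cvg_cst 0) up); apply: nearW => K; apply/andP; split.
  by rewrite mulr_ge0// tsum_ge0.
have h : (fun N => K%:R * \sum_(K.+1 <= l < N) a l) @ \oo --> K%:R * tsum a K.+1.
  by apply: cvgM; [exact: cvg_cst | exact: tsum_cvg].
apply: (ler_cvg_to h (tsum_cvg K.+1 cka)); apply: nearW => N.
rewrite mulr_sumr; apply: ler_sum_nat => l /andP[Kl _].
by rewrite ler_wpM2r// ler_nat ltnW.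
Qed.

Lemma cvgn_series_le a b : (forall l, 0 <= a l <= b l) -> cvgn (series b) ->
  cvgn (series a).
Proof.
move=> ab; apply: series_le_cvg => n; case/andP: (ab n) => // a0 h.
exact: le_trans h.
Qed.

(** Split at a fixed K: the terms with k < K see only late values of d, and the rest is at most the
    bound of d times the tail of p. *)
Lemma convolution_cvg0 p d : (forall k, 0 <= p k) -> cvgn (series p) ->
  d @ \oo --> (0 : R) ->
  (fun n => \sum_(0 <= k < n) p k * d (n - k.+1)%N) @ \oo --> (0 : R).
Proof.
move=> p0 cp d0.
have [M M0 hM] : exists2 M, 0 < M & forall n, `|d n| <= M.
  have /cvgP/cvg_has_ub[M hM] := d0.
  exists (`|M| + 1); first by rewrite ltr_wpDl.
  move=> n; apply: (@le_trans _ _ M); first by apply: hM; exists n.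
  by apply: le_trans (ler_norm _) _; rewrite lerDl.
pose S := tsum p 0; have S0 : 0 <= S by exact: tsum_ge0.
have pS K : \sum_(0 <= k < K) p k <= S.
  have := nondecreasing_cvgn_le (nondecreasing_series (m := 0) (P := xpredT) (fun k _ _ => p0 k)) cp K.
  by [].
apply/cvgrPdist_le => e e0.
have e1 : 0 < e / (2 * M) by rewrite divr_gt0// mulr_gt0.
have e2 : 0 < e / (2 * (S + 1)) by rewrite divr_gt0// mulr_gt0// ltr_wpDl.
have [K _ hK] : \forall K \near \oo, tsum p K <= e / (2 * M).
  have /cvgrPdist_le /(_ _ e1) := tsum_cvg0 cp; apply: filterS => n /=.
  by rewrite sub0r normrN ger0_norm// tsum_ge0.
have [L _ hL] : \forall L \near \oo, `|d L| <= e / (2 * (S + 1)).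
  by have /cvgrPdist_le /(_ _ e2) := d0; apply: filterS => n /=; rewrite sub0r normrN.
exists (K + L)%N => // n /= KLn; rewrite sub0r normrN.
rewrite (big_cat_nat _ (n := K))//=; last by clear -KLn; lia.
apply: le_trans (ler_normD _ _) _.
have -> : e = e / (2 * (S + 1)) * (S + 1) + e / (2 * M) * M.
  by field; rewrite !gt_eqF// ltr_wpDl.
apply: lerD.
  apply: (@le_trans _ _ (e / (2 * (S + 1)) * \sum_(0 <= k < K) p k)); last first.
    by rewrite ler_wpM2l ?(ltW e2)//; apply: le_trans (pS K) _; rewrite lerDl.
  rewrite mulr_sumr; apply: le_trans (ler_norm_sum _ _ _) _.
  apply: ler_sum_nat => k /andP[_ kK]; rewrite normrM ger0_norm// mulrC.
  by rewrite ler_wpM2r//; apply: hL => /=; clear -KLn kK; lia.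
apply: (@le_trans _ _ ((\sum_(K <= k < n) p k) * M)).
  rewrite mulr_suml; apply: le_trans (ler_norm_sum _ _ _) _.
  apply: ler_sum => k _; rewrite normrM ger0_norm//.
  by rewrite ler_wpM2l.
rewrite ler_wpM2r ?(ltW M0)//; apply: le_trans (hK K _); last exact: leqnn.
have cK := tsum_cvg K cp.
have := nondecreasing_cvgn_le (nondecreasing_series (m := K) (P := xpredT) (fun k _ _ => p0 k)) _ n.
by move=> /(_ (cvgP _ cK)).
Qed.

Lemma nneseries_real a : (forall k, 0 <= a k) ->
  (\sum_(0 <= k <oo) (a k)%:E < +oo)%E ->
  cvgn (series a) /\ (\sum_(0 <= k <oo) (a k)%:E)%E = (tsum a 0)%:E.
Proof.
move=> a0 fin.
have ca : cvgn (series a).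
  apply: nondecreasing_is_cvgn.
    exact: (nondecreasing_series (m := 0) (P := xpredT) (fun k _ _ => a0 k)).
  have S0 : (0 <= \sum_(0 <= k <oo) (a k)%:E)%E.
    by apply: nneseries_ge0 => n _ _; rewrite lee_fin.
  exists (fine (\sum_(0 <= k <oo) (a k)%:E)%E) => _ [n _ <-].
  rewrite -lee_fin fineK ?ge0_fin_numE// /series/= -sumEFin.
  by apply: nneseries_lim_ge => k _; rewrite lee_fin.
split=> //; apply/cvg_lim => //.
rewrite (_ : (fun n => _) = EFin \o series a); last first.
  by apply/funext => n /=; rewrite /series/= -sumEFin.
by apply: cvg_EFin; [exact: nearW | exact: tsum_cvg].
Qed.

End RealSums.
Arguments tsum_cvg [R a] k _.

(** * Sums over the state space as series over levels *)

Section StateSums.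
Variables (R : realType) (M0 M1 : nat).
Local Notation st k i := (existT (fun l => 'I_(lvl M0 M1 l)) k i : state M0 M1).

Lemma esum_ord n (f : 'I_n -> R) : (forall i, 0 <= f i) ->
  \esum_(i in [set: 'I_n]) (f i)%:E = (\sum_i f i)%:E.
Proof.
move=> f0; rewrite esum_fset//=; last by move=> i _; rewrite lee_fin.
have -> : [set: 'I_n] = [set` enum 'I_n].
  by apply/seteqP; split => // i _ /=; rewrite mem_enum.
by rewrite -fsbig_seq ?enum_uniq// big_enum/= sumEFin.
Qed.

Lemma esum_level (f : state M0 M1 -> R) k : (forall s, 0 <= f s) ->
  \esum_(s in [set s : state M0 M1 | tag s = k]) (f s)%:E =
  (\sum_i f (st k i))%:E.
Proof.
move=> f0.
have -> : [set s : state M0 M1 | tag s = k] = (fun i => st k i) @` [set: 'I_(lvl M0 M1 k)].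
  apply/seteqP; split => [[k' i] /= kk'|_ [i _ <-]//].
  by subst k'; exists i.
rewrite esum_image; last first.
  by move=> i j _ _ /eqP; rewrite eq_Tagged => /eqP.
exact: esum_ord.
Qed.

Lemma esum_state (f : state M0 M1 -> R) : (forall s, 0 <= f s) ->
  \esum_(s in [set: state M0 M1]) (f s)%:E =
  (\sum_(0 <= k <oo) (\sum_i f (st k i))%:E)%E.
Proof.
move=> f0.
have -> : [set: state M0 M1] = \bigcup_k [set s : state M0 M1 | tag s = k].
  by apply/seteqP; split => // s _; exists (tag s).
rewrite nneseries_sum_bigcup.
- by apply: eq_eseriesr => k _; rewrite esum_level.
- apply/trivIsetP => i j _ _ /eqP ij; apply/seteqP; split => // s [/= si sj].
  by apply: ij; rewrite -si -sj.
- by move=> s; rewrite lee_fin.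
Qed.

Lemma esum_state_cvg (f : state M0 M1 -> R) (r : R) : (forall s, 0 <= f s) ->
  \esum_(s in [set: state M0 M1]) (f s)%:E = r%:E ->
  series (fun k => \sum_i f (st k i)) @ \oo --> r.
Proof.
move=> f0; rewrite esum_state// => fr.
have h : (\sum_(0 <= k <oo) (\sum_i f (st k i))%:E < +oo)%E by rewrite fr ltry.
have S0 k : 0 <= \sum_i f (st k i) by rewrite sumr_ge0.
have [c E] := nneseries_real S0 h.
by have := tsum_cvg 0 c; rewrite E in fr; case: fr => ->.
Qed.

End StateSums.

(** * Crossing identities for abstract tails, common to the chain and its truncation *)

Section Balance.
Variables (R : realType) (M0 M1 : nat).
Variables (p0 : 'rV[R]_M0) (p y : nat -> 'rV[R]_M1).
Variables (A Ab : nat -> 'M[R]_M1) (At : 'M[R]_M1) (B Bb : nat -> 'M[R]_(M0, M1)).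
Hypothesis p_ge0 : forall k i, 0 <= p k 0 i.
Hypothesis yS : forall n, y n = p n + y n.+1.
Hypothesis y_cvg0 : forall i, (fun n => y n 0 i) @ \oo --> (0 : R).
Hypothesis p_cvg : forall i, cvgn (series (fun k => p k 0 i)).
Hypothesis AbS : forall n, Ab n = A n.+2 + Ab n.+1.
Hypothesis Ab0 : At = A 0 + A 1 + Ab 0.
Hypothesis Ab_cvg0 : forall i j, (fun n => Ab n i j) @ \oo --> (0 : R).
Hypothesis BbS : forall n, Bb n = B n + Bb n.+1.
Hypothesis Bb_cvg0 : forall i j, (fun n => Bb n i j) @ \oo --> (0 : R).
Hypothesis balance : forall l,
  p l = p0 *m B l + \sum_(0 <= k < l.+2) p k *m A (l.+1 - k)%N.

Let const_cvg0 (u : nat -> R) n : (forall k, u k.+1 = u k) ->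
  u @ \oo --> (0 : R) -> u n = 0.
Proof.
move=> uc u0; have E k : u k = u 0 by elim: k => // k IH; rewrite uc.
have cst : (fun=> u 0) @ \oo --> (0 : R).
  by rewrite [X in X @ _ --> _](_ : _ = u)//; apply/esym/funext.
by rewrite E -(cvg_lim (@Rhausdorff R) cst) lim_cst//; exact: Rhausdorff.
Qed.

Let mul_cvg0 m n (q : 'rV[R]_m) (C : nat -> 'M[R]_(m, n)) j :
  (forall i, (fun k => C k i j) @ \oo --> (0 : R)) ->
  (fun k => (q *m C k) 0 j) @ \oo --> (0 : R).
Proof.
move=> C0; under eq_fun do rewrite mxE.
by apply: cvgn_sum0 => i _; apply: cvgn_mull0; exact: C0.
Qed.

Let cvg0_mul n (q : nat -> 'rV[R]_M1) (C : 'M[R]_(M1, n)) j :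
  (forall i, (fun k => q k 0 i) @ \oo --> (0 : R)) ->
  (fun k => (q k *m C) 0 j) @ \oo --> (0 : R).
Proof.
move=> q0; under eq_fun do rewrite mxE.
apply: cvgn_sum0 => i _; under eq_fun do rewrite mulrC.
by apply: cvgn_mull0; exact: q0.
Qed.

Let conv_cvg0 n (C : nat -> 'M[R]_(M1, n)) j :
  (forall i, (fun k => C k i j) @ \oo --> (0 : R)) ->
  (fun m => (\sum_(0 <= k < m) p k *m C (m - k.+1)%N) 0 j) @ \oo --> (0 : R).
Proof.
move=> C0.
rewrite (_ : (fun m => _) = (fun m => \sum_(i < M1) \sum_(0 <= k < m)
    p k 0 i * C (m - k.+1)%N i j)); last first.
  apply/funext => m; rewrite summxE exchange_big/=.
  by apply: eq_bigr => k _; rewrite mxE.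
apply: cvgn_sum0 => i _.
exact: (convolution_cvg0 (fun k => p_ge0 k i) (@p_cvg i) (C0 i)).
Qed.

Let p_cvg0 i : (fun k => p k 0 i) @ \oo --> (0 : R).
Proof. exact: cvg_series_cvg_0. Qed.

(** The difference of the two sides does not depend on n, by the balance equation of one level, and
    tends to 0; hence it vanishes. This replaces a summation of the balance equations over
    infinitely many levels. The term p n A 0 is the downward flow out of the lowest level counted in
    y n. *)
Lemma level_crossing n :
  y n + p n *m A 0 =
  y n *m At + p0 *m Bb n + \sum_(0 <= k < n) p k *m Ab (n - k.+1)%N.
Proof.
apply/rowP => j.
pose u k := (y k + p k *m A 0) 0 j -
  (y k *m At + p0 *m Bb k + \sum_(0 <= l < k) p l *m Ab (k - l.+1)%N) 0 j.
suff : u n = 0 by move/eqP; rewrite subr_eq0 => /eqP.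
apply: const_cvg0.
  move=> k; rewrite /u.
  have e1 := congr1 (fun v : 'rV_M1 => v 0 j) (balance k).
  have e2 : (\sum_(0 <= l < k) p l *m Ab (k - l.+1)%N) =
     \sum_(0 <= l < k) p l *m A (k.+1 - l)%N + \sum_(0 <= l < k) p l *m Ab (k - l)%N.
    rewrite -big_split/=; apply: eq_big_nat => l /andP[_ lk].
    rewrite AbS mulmxDr; congr (_ *m A _ + _ *m Ab _); lia.
  have e3 : \sum_(0 <= l < k.+1) p l *m Ab (k.+1 - l.+1)%N =
     \sum_(0 <= l < k) p l *m Ab (k - l)%N + p k *m Ab 0.
    by rewrite big_nat_recr//= subSS subnn; under eq_bigr do rewrite subSS.
  move: e1; rewrite e2 e3 (yS k) (BbS k) Ab0.
  rewrite big_nat_recr//= big_nat_recr//= subnn subSnn.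
  rewrite !mulmxDl !mulmxDr.
  set s1 := \sum_(0 <= l < k) _; set s2 := \sum_(0 <= l < k) _.
  have addE (v v' : 'rV[R]_M1) : (v + v') 0 j = v 0 j + v' 0 j by rewrite mxE.
  by rewrite !addE; lra.
apply: cvgn_sub0.
  under eq_fun do rewrite mxE.
  by apply: cvgn_add0; [exact: y_cvg0 | exact: cvg0_mul].
under eq_fun do rewrite mxE [X in X + _]mxE.
apply: cvgn_add0; last exact: conv_cvg0.
by apply: cvgn_add0; [exact: cvg0_mul | exact: mul_cvg0].
Qed.

Variables (D : nat -> 'cV[R]_M1) (DB : nat -> 'cV[R]_M0).
Hypothesis Ate : At *m ones R M1 = ones R M1.
Hypothesis DS : forall n, D n = Ab n *m ones R M1 + D n.+1.
Hypothesis D_cvg0 : forall i, (fun n => D n i 0) @ \oo --> (0 : R).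
Hypothesis DBS : forall n, DB n = Bb n *m ones R M1 + DB n.+1.
Hypothesis DB_cvg0 : forall i, (fun n => DB n i 0) @ \oo --> (0 : R).

(** The same device: the increment in n of the claimed identity is the level-crossing identity
    multiplied by the vector of ones, where [Ate] cancels y n. *)
Lemma total_crossing n :
  (y n *m (A 0 *m ones R M1)) 0 0 =
  (y n *m D 0) 0 0 + (p0 *m DB n) 0 0 + \sum_(0 <= k < n) (p k *m D (n - k.+1)%N) 0 0.
Proof.
have addE (v v' : 'rV[R]_1) : (v + v') 0 0 = v 0 0 + v' 0 0 by rewrite mxE.
pose u k := (y k *m (A 0 *m ones R M1)) 0 0 - ((y k *m D 0) 0 0 + (p0 *m DB k) 0 0 +
  (\sum_(0 <= l < k) p l *m D (k - l.+1)%N) 0 0).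
suff : u n = 0 by rewrite /u summxE => /eqP; rewrite subr_eq0 => /eqP.
apply: const_cvg0.
  move=> k; rewrite /u.
  have := congr1 (fun v : 'rV_M1 => (v *m ones R M1) 0 0) (level_crossing k).
  rewrite /= !mulmxDl -!mulmxA Ate.
  have e2 : (\sum_(0 <= l < k) p l *m D (k - l.+1)%N) =
     (\sum_(0 <= l < k) p l *m Ab (k - l.+1)%N) *m ones R M1 +
       \sum_(0 <= l < k) p l *m D (k - l)%N.
    rewrite mulmx_suml -big_split/=; apply: eq_big_nat => l /andP[_ lk].
    by rewrite DS mulmxDr mulmxA; congr (_ + _ *m D _); lia.
  have e3 : \sum_(0 <= l < k.+1) p l *m D (k.+1 - l.+1)%N =
     \sum_(0 <= l < k) p l *m D (k - l)%N + p k *m D 0.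
    by rewrite big_nat_recr//= subSS subnn; under eq_bigr do rewrite subSS.
  rewrite e2 e3 (yS k) (DBS k) !mulmxDl !mulmxDr !addE; lra.
apply: cvgn_sub0; first exact: cvg0_mul.
apply: cvgn_add0; last exact: conv_cvg0.
by apply: cvgn_add0; [exact: cvg0_mul | exact: mul_cvg0].
Qed.

End Balance.

(** * The Poisson equation of an irreducible stochastic matrix *)

Section MoreRealSums.
Variable R : realType.
Implicit Types a b : nat -> R.

Lemma cvgn_series_shift a : cvgn (series a) = cvgn (series (fun k => a k.+1)).
Proof.
have -> : series (fun k => a k.+1) = (fun n => \sum_(1 <= k < n.+1) a k).
  by apply/funext => n; rewrite /series/= big_add1.
rewrite -(is_cvg_series_restrict 1 a); apply/propext.
split=> /cvg_ex[l h]; apply/cvg_ex; exists l; move: h;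
  by rewrite (cvg_shiftS (fun n => \sum_(1 <= k < n) a k)).
Qed.

Lemma tsum_shift a k : cvgn (series a) -> tsum (fun l => a l.+1) k = tsum a k.+1.
Proof.
move=> ca; rewrite /tsum; apply/cvg_lim => //.
rewrite [X in X @ _](_ : _ = (fun K => \sum_(k.+1 <= l < K.+1) a l)); last first.
  by apply/funext => K; rewrite big_add1.
rewrite (cvg_shiftS (fun n => \sum_(k.+1 <= l < n) a l)); exact: tsum_cvg.
Qed.

Lemma eq_tsum a b k : (forall l, (k <= l)%N -> a l = b l) -> tsum a k = tsum b k.
Proof.
move=> ab; rewrite /tsum; suff -> : (fun K => \sum_(k <= l < K) a l) =
  (fun K => \sum_(k <= l < K) b l) by [].
by apply/funext => n; apply: eq_big_nat => l /andP[kl _]; exact: ab.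
Qed.

Lemma tsum_sum n (f : 'I_n -> nat -> R) k : (forall i, cvgn (series (f i))) ->
  tsum (fun l => \sum_i f i l) k = \sum_i tsum (f i) k.
Proof.
move=> cf; apply/cvg_lim => //; under eq_fun do rewrite exchange_big/=.
by apply: cvgn_sum => i _; exact: tsum_cvg.
Qed.

End MoreRealSums.

Section FundamentalMatrix.
Variables (R : realType) (n : nat) (A : 'M[R]_n) (w : 'rV[R]_n).
Hypothesis hA : stochastic (fun i j => A i j).
Hypothesis hAirr : irreducible_mat (fun i j => A i j).
Hypothesis hw : stationary (fun i j => A i j) (fun i => w 0 i).

Lemma stochastic_mulmx_ones : A *m ones R n = ones R n.
Proof.
apply/colP => i; rewrite !mxE; have := hA.2 i.
rewrite esum_ord; last exact: hA.1.
by case=> <-; apply: eq_bigr => j _; rewrite mxE mulr1.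
Qed.

Lemma stationary_mulmx : w *m A = w.
Proof.
have [w0 _ wA] := hw; apply/rowP => j; rewrite mxE; have := wA j.
rewrite esum_ord; last by move=> i; rewrite mulr_ge0//; exact: hA.1.
by case.
Qed.

Lemma stationary_mulmx_ones : (w *m ones R n) 0 0 = 1.
Proof.
have [w0 w1 _] := hw; move: w1; rewrite esum_ord// => -[<-].
by rewrite mxE; apply: eq_bigr => i _; rewrite mxE mulr1.
Qed.

(** Maximum principle: where b is maximal, averaging forces the same value at every state reached
    with positive probability, and irreducibility spreads it everywhere. *)
Lemma harmonic_constant (b : 'cV[R]_n) : A *m b = b -> forall i j, b i 0 = b j 0.
Proof.
move=> Ab i j; pose i0 := [arg max_(k > i) b k 0]%O.
have bmax k : b k 0 <= b i0 0.
  by rewrite /i0; case: arg_maxP => // k0 _ h; exact: h.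
suff E k : b i0 0 - b k 0 = 0.
  by have := E i; have := E j; lra.
apply: (irreducible_closed (P := fun k => b i0 0 - b k 0 = 0) hAirr _ (subrr _)).
move=> s t hs st; have := congr1 (fun v : 'cV_n => v s 0) Ab.
have := congr1 (fun v : 'cV_n => v s 0) stochastic_mulmx_ones.
rewrite /= !mxE => e1 e2.
have : \sum_k A s k * (b i0 0 - b k 0) = 0.
  under eq_bigr do rewrite mulrBr.
  rewrite sumrB e2 -mulr_suml; move: e1; under eq_bigr do rewrite mxE mulr1.
  by move=> ->; rewrite mul1r.
move/eqP; rewrite psumr_eq0; last first.
  by move=> u _; rewrite mulr_ge0 ?subr_ge0//; exact: hA.1.
move=> /allP /(_ t); rewrite mem_index_enum => /(_ isT) /=.
by rewrite mulf_eq0 gt_eqF//= => /eqP.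
Qed.

(** The inverse of this matrix is what is usually called the fundamental matrix of the chain; the
    rank-one term removes the kernel of I - A. *)
Definition fundamental_mx : 'M[R]_n := 1%:M - A + ones R n *m w.

Lemma mul_fundamental_mx (v : 'rV[R]_n) :
  v *m fundamental_mx = v - v *m A + (v *m ones R n) 0 0 *: w.
Proof.
rewrite /fundamental_mx mulmxDr mulmxBr mulmx1 mulmxA.
by rewrite {1}[v *m ones R n]mx11_scalar mul_scalar_mx.
Qed.

(** For a kernel vector b, multiplying by w on the left gives w b = 0; then A b = b, so b is
    constant, and its w-average 0 makes it zero. *)
Lemma fundamental_mx_unit : fundamental_mx \in unitmx.
Proof.
rewrite unitmxE unitfE -det_tr; apply/negP => /det0P [v v0 vZ].
have Zb : fundamental_mx *m v^T = 0.
  by rewrite -[LHS]trmxK trmx_mul trmxK vZ trmx0.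
have wb : w *m v^T = 0.
  rewrite -[RHS](mulmx0 _ w) -Zb mulmxA mul_fundamental_mx.
  by rewrite stationary_mulmx subrr add0r stationary_mulmx_ones scale1r.
have Ab : A *m v^T = v^T.
  move: Zb; rewrite /fundamental_mx mulmxDl -mulmxA wb mulmx0 addr0 mulmxBl mul1mx.
  by move/eqP; rewrite subr_eq0 => /eqP.
have /rV0Pn[i /eqP vi] := v0; apply: vi.
have := congr1 (fun u : 'M[R]_(1, 1) => u 0 0) wb; rewrite !mxE.
under eq_bigr => j _ do rewrite (harmonic_constant Ab j i).
rewrite -mulr_suml (_ : \sum_j w 0 j = 1); last first.
  rewrite -stationary_mulmx_ones mxE.
  by apply: eq_bigr => j _; rewrite mxE mulr1.
by rewrite mul1r mxE => ->.
Qed.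

(** The right side has w-average 0, and w is fixed by the matrix from the left, so w a = 0 and the
    rank-one term drops out. *)
Lemma poisson_equation (m : 'cV[R]_n) (sigma : R) : (w *m m) 0 0 = sigma ->
  exists a : 'cV[R]_n, a - A *m a = m - sigma *: ones R n.
Proof.
move=> wm; pose a := invmx fundamental_mx *m (m - sigma *: ones R n).
have Za : fundamental_mx *m a = m - sigma *: ones R n.
  by rewrite mulKVmx// fundamental_mx_unit.
have wa : w *m a = 0.
  transitivity (w *m fundamental_mx *m a).
    rewrite mul_fundamental_mx stationary_mulmx subrr add0r.
    by rewrite stationary_mulmx_ones scale1r.
  rewrite -mulmxA Za mulmxBr -scalemxAr [w *m m]mx11_scalar wm.
  by rewrite [w *m ones R n]mx11_scalar stationary_mulmx_ones scalemx1 subrr.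
exists a; rewrite -Za /fundamental_mx mulmxDl -mulmxA wa mulmx0 addr0.
by rewrite mulmxBl mul1mx.
Qed.

End FundamentalMatrix.

(** * The balance equations in block form *)

Section Blocks.
Variables (R : realType) (M0 M1 : nat).
Local Notation st k i := (existT (fun l => 'I_(lvl M0 M1 l)) k i : state M0 M1).
Implicit Types (Q : blocks R M0 M1) (x : state M0 M1 -> R).

(* Indexed so that every block A(k), k >= -1, is reached from a natural number. *)
Definition stepA Q (n : nat) : 'M[R]_M1 := blkA Q (n%:Z - 1).

Lemma blkA_stepA Q (k : nat) : blkA Q k%:Z = stepA Q k.+1.
Proof. by rewrite /stepA -addn1 PoszD addrK. Qed.

(** A row of level 2 displays every block A(k), k >= -1; in level 1 the place of A(-1) is taken by
    B(-1). *)
Lemma stepA_ge0 Q n i j : (forall s t, 0 <= MG1mat Q s t) -> 0 <= stepA Q n i j.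
Proof. by move=> /(_ (st 2 i) (st n.+1 j)). Qed.

Lemma blkB_ge0 Q l i j : (forall s t, 0 <= MG1mat Q s t) -> 0 <= blkB Q l.+1 i j.
Proof. by move=> /(_ (st 0 i) (st l.+1 j)). Qed.

(** Transitions descend by at most one level, so level l + 1 is fed by levels 0 to l + 2 only and
    the sum over all states is finite. *)
Lemma level_balance Q x l : (forall s t, 0 <= MG1mat Q s t) ->
  stationary (MG1mat Q) x ->
  level x l.+1 = level x 0 *m blkB Q l.+1 +
    \sum_(0 <= k < l.+2) (level x k.+1 : 'rV_M1) *m stepA Q (l.+1 - k)%N
    :> 'rV[R]_M1.
Proof.
move=> P0 [x0 _ xP]; apply/rowP => j.
have h := esum_state_cvg (fun s => mulr_ge0 (x0 s) (P0 s (st l.+1 j))) (xP (st l.+1 j)).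
set f := (fun k => _) in h.
have f0 : f 0%N = (level x 0 *m blkB Q l.+1) 0 j.
  by rewrite /f [RHS]mxE; apply: eq_bigr => i _; rewrite mxE.
have fS k : (k < l.+2)%N ->
    f k.+1 = ((level x k.+1 : 'rV_M1) *m stepA Q (l.+1 - k)%N) 0 j.
  move=> kl; rewrite /f [RHS]mxE; apply: eq_bigr => i _; rewrite mxE.
  congr (_ * _); rewrite /MG1mat /= /stepA.
  case: k kl i => [|k] kl i /=; last rewrite -ltnS kl.
    by rewrite subr0 subn0 -addn1 PoszD addrK.
  congr (blkA Q _ i j); lia.
have f_eq0 k : (l.+2 <= k)%N -> f k.+1 = 0.
  move=> lk; rewrite /f big1// => i _; rewrite /MG1mat /=.
  case: k lk i => // k lk i; rewrite leqNgt ltnS.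
  by rewrite (_ : (l < k)%N)//= mxE mulr0.
rewrite [LHS]mxE [RHS]mxE summxE.
suff : series f @ \oo --> f 0%N + \sum_(0 <= k < l.+2) f k.+1.
  move=> h2; rewrite -(cvg_lim (@Rhausdorff R) h) (cvg_lim (@Rhausdorff R) h2).
  by rewrite f0; congr (_ + _); apply: eq_big_nat => k /andP[_ kl]; rewrite fS.
rewrite -(cvg_shiftn l.+3); apply: cvg_near_cst; apply: nearW => n.
rewrite /series/= addnS big_nat_recl//; congr (_ + _).
rewrite (big_cat_nat _ (n := l.+2))//=; last exact: leq_addl.
rewrite [X in _ + X]big_nat_cond [X in _ + X]big1 ?addr0// => k.
by rewrite andbT => /andP[lk _]; exact: f_eq0.
Qed.

End Blocks.

(** * Tail and excess blocks *)

Section BlockTails.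
Variables (R : realType) (M0 M1 : nat) (Q : blocks R M0 M1).
Local Notation st k i := (existT (fun l => 'I_(lvl M0 M1 l)) k i : state M0 M1).
Hypothesis hP : stochastic (MG1mat Q).

Lemma stepA_cvg i j : cvgn (series (fun n => stepA Q n i j)).
Proof.
have /cvgP c := esum_state_cvg (fun t => hP.1 (st 2 i) t) (hP.2 (st 2 i)).
rewrite cvgn_series_shift in c; move: c; apply: cvgn_series_le => n.
apply/andP; split; first by rewrite stepA_ge0//; exact: hP.1.
rewrite (bigD1 (j : 'I_(lvl M0 M1 n.+1)))//= -[leLHS]addr0 lerD//.
by rewrite sumr_ge0// => k _; exact: hP.1.
Qed.

Lemma blkA_cvg i j : cvgn (series (fun l => blkA Q l%:Z i j)).
Proof.
rewrite (_ : (fun l => _) = (fun l => stepA Q l.+1 i j)).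
  by rewrite -(cvgn_series_shift (fun n => stepA Q n i j)); exact: stepA_cvg.
by apply/funext => l; rewrite blkA_stepA.
Qed.

Lemma blkB_cvg i j : cvgn (series (fun l => blkB Q l i j)).
Proof.
have /cvgP c := esum_state_cvg (fun t => hP.1 (st 0 i) t) (hP.2 (st 0 i)).
rewrite cvgn_series_shift in c; rewrite cvgn_series_shift.
move: c; apply: cvgn_series_le => n; apply/andP; split.
  by rewrite blkB_ge0//; exact: hP.1.
rewrite (bigD1 (j : 'I_(lvl M0 M1 n.+1)))//= -[leLHS]addr0 lerD//.
by rewrite sumr_ge0// => k _; exact: hP.1.
Qed.

Lemma tailAE k i j : tailA Q k i j = tsum (fun l => blkA Q l%:Z i j) k.+1.
Proof. by rewrite mxE. Qed.

Lemma tailBE k i j : tailB Q k i j = tsum (fun l => blkB Q l i j) k.+1.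
Proof. by rewrite mxE. Qed.

Lemma blkA_ge0 (l : nat) i j : 0 <= blkA Q l i j.
Proof. by rewrite blkA_stepA stepA_ge0//; exact: hP.1. Qed.

Lemma tailA_ge0 k i j : 0 <= tailA Q k i j.
Proof.
rewrite tailAE; apply: tsum_ge0; last exact: blkA_cvg.
by move=> l; exact: blkA_ge0.
Qed.

Lemma tailB_ge0 k i j : 0 <= tailB Q k i j.
Proof.
rewrite tailBE -tsum_shift; last exact: blkB_cvg.
apply: tsum_ge0; first by move=> l; rewrite blkB_ge0//; exact: hP.1.
by rewrite -(cvgn_series_shift (fun l => blkB Q l i j)); exact: blkB_cvg.
Qed.

Lemma tailAS n : tailA Q n = stepA Q n.+2 + tailA Q n.+1.
Proof.
apply/matrixP => i j; rewrite [RHS]mxE !tailAE -blkA_stepA.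
by apply: tsumS; exact: blkA_cvg.
Qed.

Lemma tailBS n : tailB Q n = blkB Q n.+1 + tailB Q n.+1.
Proof.
apply/matrixP => i j; rewrite [RHS]mxE !tailBE.
by apply: tsumS; exact: blkB_cvg.
Qed.

Lemma sumAE : sumA Q = stepA Q 0 + stepA Q 1 + tailA Q 0.
Proof.
rewrite -addrA; apply/matrixP => i j; rewrite [LHS]mxE [RHS]mxE.
congr (_ + _); rewrite [RHS]mxE tailAE -blkA_stepA mxE.
by apply: tsumS; exact: blkA_cvg.
Qed.

Lemma tailA_cvg0 i j : (fun n => tailA Q n i j) @ \oo --> (0 : R).
Proof.
rewrite (_ : (fun n => _) = (fun n => tsum (fun l => blkA Q l%:Z i j) n.+1)).
  by rewrite cvg_shiftS; apply: tsum_cvg0; exact: blkA_cvg.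
by apply/funext => n; rewrite tailAE.
Qed.

Lemma tailB_cvg0 i j : (fun n => tailB Q n i j) @ \oo --> (0 : R).
Proof.
rewrite (_ : (fun n => _) = (fun n => tsum (fun l => blkB Q l i j) n.+1)).
  by rewrite cvg_shiftS; apply: tsum_cvg0; exact: blkB_cvg.
by apply/funext => n; rewrite tailBE.
Qed.

(** This is D_A(n), with [excessB] for D_B(n). Since [ttailA Q n] sums from n + 1, the hypotheses on
    F concern the excess at n + 1; long-tailedness absorbs the shift. *)
Definition excessA n : 'cV[R]_M1 := sum_from n (tailA Q) *m ones R M1.
Definition excessB n : 'cV[R]_M0 := sum_from n (tailB Q) *m ones R M1.

Lemma mulmx_ones m n (C : 'M[R]_(m, n)) i : (C *m ones R n) i 0 = \sum_j C i j.
Proof. by rewrite mxE; apply: eq_bigr => j _; rewrite mxE mulr1. Qed.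

Lemma excessAE n i : excessA n i 0 = \sum_j tsum (fun l => tailA Q l i j) n.
Proof. by rewrite mulmx_ones; apply: eq_bigr => j _; rewrite mxE. Qed.

Lemma excessBE n i : excessB n i 0 = \sum_j tsum (fun l => tailB Q l i j) n.
Proof. by rewrite mulmx_ones; apply: eq_bigr => j _; rewrite mxE. Qed.

Lemma cvgn_series_entry n (f : 'I_n -> nat -> R) (j : 'I_n) :
  (forall i k, 0 <= f i k) -> cvgn (series (fun k => k%:R * \sum_i f i k)) ->
  cvgn (series (fun k => k%:R * f j k)).
Proof.
move=> f0; apply: cvgn_series_le => k; rewrite mulr_ge0//=.
by rewrite ler_wpM2l// (bigD1 j)//= lerDl sumr_ge0.
Qed.

Section FiniteMeanA.
Hypothesis hm : forall i, (meanA Q i < +oo)%E.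

Let Ae_ge0 i k : 0 <= k%:R * (blkA Q k%:Z *m ones R M1) i 0.
Proof. by rewrite mulr_ge0// mulmx_ones sumr_ge0// => j _; exact: blkA_ge0. Qed.

Let mean_fin i : cvgn (series (fun k => k%:R * (blkA Q k%:Z *m ones R M1) i 0)) /\
  (\sum_(0 <= k <oo) (k%:R * (blkA Q k%:Z *m ones R M1) i 0)%:E =
   (tsum (fun k => k%:R * (blkA Q k%:Z *m ones R M1) i 0) 0)%:E)%E.
Proof.
apply: nneseries_real => //; have := hm i; rewrite /meanA.
set S := (\sum_(0 <= k <oo) _)%E.
have : (0 <= S)%E by apply: nneseries_ge0 => k _ _; rewrite lee_fin.
by case: S => [r| |]//= _ _; exact: ltry.
Qed.

Let entry_cvg i j : cvgn (series (fun k => k%:R * blkA Q k%:Z i j)).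
Proof.
apply: (cvgn_series_entry (f := fun j k => blkA Q k%:Z i j)).
  by move=> *; exact: blkA_ge0.
have [+ _] := mean_fin i; rewrite (_ : (fun k => _) = (fun k : nat =>
  k%:R * \sum_j blkA Q k%:Z i j))//.
by apply/funext => k; rewrite mulmx_ones.
Qed.

Let tail_mean i j : series (fun n => tailA Q n i j) @ \oo -->
  tsum (fun k => k%:R * blkA Q k%:Z i j) 0.
Proof.
rewrite (_ : (fun n => _) = (fun n => tsum (fun l => blkA Q l%:Z i j) n.+1)).
  by apply: tsum_mean; [move=> l; exact: blkA_ge0 | exact: blkA_cvg | exact: entry_cvg].
by apply/funext => n; rewrite tailAE.
Qed.

Let tail_cvg i j : cvgn (series (fun n => tailA Q n i j)).
Proof. exact: cvgP (@tail_mean i j). Qed.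

Lemma excessAS n : excessA n = tailA Q n *m ones R M1 + excessA n.+1.
Proof.
rewrite /excessA -mulmxDl; congr (_ *m _); apply/matrixP => i j.
rewrite [LHS]mxE [RHS]mxE [X in _ + X]mxE; by apply: tsumS; exact: tail_cvg.
Qed.

Lemma excessA_cvg0 i : (fun n => excessA n i 0) @ \oo --> (0 : R).
Proof.
under eq_fun do rewrite excessAE.
by apply: cvgn_sum0 => j _; apply: tsum_cvg0; exact: tail_cvg.
Qed.

Lemma excessA_ge0 n i : 0 <= excessA n i 0.
Proof.
rewrite excessAE sumr_ge0// => j _; apply: tsum_ge0; last exact: tail_cvg.
by move=> l; exact: tailA_ge0.
Qed.

(** The positive part of the mean is the sum of the tails, which is the excess at 0; the step down
    contributes - A(-1)e. *)
Lemma meanAE i : meanA Q i = ((excessA 0 - stepA Q 0 *m ones R M1) i 0)%:E.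
Proof.
have -> : (excessA 0 - stepA Q 0 *m ones R M1) i 0 =
    - (stepA Q 0 *m ones R M1) i 0 + excessA 0 i 0.
  by rewrite [LHS]mxE [X in _ + X]mxE addrC.
rewrite /meanA (mean_fin i).2 -EFinD.
have -> : blkA Q (- 1) = stepA Q 0 by rewrite /stepA sub0r.
congr (_ + _)%:E; rewrite excessAE.
transitivity (tsum (fun k => \sum_j k%:R * blkA Q k%:Z i j) 0).
  by apply: eq_tsum => k _; rewrite mulmx_ones mulr_sumr.
rewrite tsum_sum//; apply: eq_bigr => j _; apply/esym.
by apply: (cvg_unique _ (tsum_cvg 0 (@tail_cvg i j)) (@tail_mean i j)); exact: Rhausdorff.
Qed.

End FiniteMeanA.

Section FiniteMeanB.
Hypothesis hm : forall i, (meanB Q i < +oo)%E.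

(** The value [blkB Q 0] is not a block of the chain and may have any sign; it is masked by 0 to
    keep the series nonnegative. *)
Let b i j (k : nat) : R := if k is l.+1 then blkB Q l.+1 i j else 0.

Let b_ge0 i j k : 0 <= b i j k.
Proof. by case: k => //= k; rewrite blkB_ge0//; exact: hP.1. Qed.

Let b_cvg i j : cvgn (series (b i j)).
Proof.
rewrite cvgn_series_shift -(cvgn_series_shift (fun l => blkB Q l i j)).
exact: blkB_cvg.
Qed.

Let bk_cvg i j : cvgn (series (fun k => k%:R * b i j k)).
Proof.
apply: (cvgn_series_entry (f := b i)) => //.
apply: (proj1 (nneseries_real _ _)).
  by move=> k; rewrite mulr_ge0// sumr_ge0.
apply: le_lt_trans (hm i); rewrite le_eqVlt; apply/orP; left; apply/eqP.
rewrite /meanB; congr (limn _); apply/funext => -[|n]; first by rewrite !big_geq.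
rewrite big_ltn// mul0r add0e; apply: eq_big_nat => -[//|k] _.
by rewrite mulmx_ones.
Qed.

Let tail_cvg i j : cvgn (series (fun n => tailB Q n i j)).
Proof.
rewrite (_ : (fun n => _) = (fun n => tsum (b i j) n.+1)).
  exact: cvgP (tsum_mean (b_ge0 i j) (@b_cvg i j) (@bk_cvg i j)).
by apply/funext => n; rewrite tailBE; apply: eq_tsum; case.
Qed.

Lemma excessBS n : excessB n = tailB Q n *m ones R M1 + excessB n.+1.
Proof.
rewrite /excessB -mulmxDl; congr (_ *m _); apply/matrixP => i j.
rewrite [LHS]mxE [RHS]mxE [X in _ + X]mxE; by apply: tsumS; exact: tail_cvg.
Qed.

Lemma excessB_cvg0 i : (fun n => excessB n i 0) @ \oo --> (0 : R).
Proof.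
under eq_fun do rewrite excessBE.
by apply: cvgn_sum0 => j _; apply: tsum_cvg0; exact: tail_cvg.
Qed.

Lemma excessB_ge0 n i : 0 <= excessB n i 0.
Proof.
rewrite excessBE sumr_ge0// => j _; apply: tsum_ge0; last exact: tail_cvg.
by move=> l; exact: tailB_ge0.
Qed.

End FiniteMeanB.
End BlockTails.

(** * The level-increment truncation *)

Section LevelSums.
Variables (R : realType) (M0 M1 : nat) (x : state M0 M1 -> R).
Local Notation st k i := (existT (fun l => 'I_(lvl M0 M1 l)) k i : state M0 M1).
Hypothesis x0 : forall s, 0 <= x s.
Hypothesis x1 : \esum_(s in [set: state M0 M1]) (x s)%:E = 1%E.

Definition plevel (k : nat) : 'rV[R]_M1 := level x k.+1.

Lemma level_ge0 k i : 0 <= level x k 0 i.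
Proof. by rewrite mxE. Qed.

Lemma plevel_ge0 k i : 0 <= plevel k 0 i.
Proof. exact: level_ge0. Qed.

Lemma plevel_cvg i : cvgn (series (fun k => plevel k 0 i)).
Proof.
have /cvgP c := esum_state_cvg x0 x1.
rewrite cvgn_series_shift in c; move: c; apply: cvgn_series_le => k.
rewrite plevel_ge0/= (bigD1 (i : 'I_(lvl M0 M1 k.+1)))//= -[leLHS]addr0 lerD//.
  by rewrite /plevel mxE.
by rewrite sumr_ge0.
Qed.

Lemma tail_levelsE n i : tail_levels x n 0 i = tsum (fun k => plevel k 0 i) n.
Proof. by rewrite mxE. Qed.

Lemma tail_levelsS n : tail_levels x n = plevel n + tail_levels x n.+1.
Proof.
apply/rowP => i; rewrite [RHS]mxE !tail_levelsE.
by apply: tsumS; exact: plevel_cvg.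
Qed.

Lemma tail_levels_ge0 n i : 0 <= tail_levels x n 0 i.
Proof.
rewrite tail_levelsE; apply: tsum_ge0; last exact: plevel_cvg.
by move=> k; exact: plevel_ge0.
Qed.

Lemma tail_levels_cvg0 i : (fun n => tail_levels x n 0 i) @ \oo --> (0 : R).
Proof.
under eq_fun do rewrite tail_levelsE.
by apply: tsum_cvg0; exact: plevel_cvg.
Qed.

Lemma total_mass :
  (level x 0 *m ones R M0) 0 0 + (tail_levels x 0 *m ones R M1) 0 0 = 1.
Proof.
have h := esum_state_cvg x0 x1.
have c := cvgP _ h.
have -> : (1 : R) = tsum (fun k => \sum_i x (st k i)) 0.
  apply: (cvg_unique _ h (tsum_cvg 0 c)); exact: Rhausdorff.
rewrite tsumS//; congr (_ + _).
  by rewrite mulmx_ones; apply: eq_bigr => i _; rewrite mxE.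
rewrite mulmx_ones -tsum_shift//.
under eq_bigr do rewrite tail_levelsE.
rewrite -tsum_sum; last exact: plevel_cvg.
by apply: eq_tsum => k _; apply: eq_bigr => i _; rewrite mxE.
Qed.

End LevelSums.

(** * Comparison of the truncated transition matrix with the original one *)

Section Truncation.
Variables (R : realType) (M0 M1 : nat) (Q : blocks R M0 M1) (N : nat).
Local Notation st k i := (existT (fun l => 'I_(lvl M0 M1 l)) k i : state M0 M1).
Hypothesis hP : stochastic (MG1mat Q).
Hypothesis N0 : (0 < N)%N.
Let Q' := LItrunc N Q.

Lemma stepA_LItrunc n : stepA Q' n =
  if (n <= N)%N then stepA Q n else if n == N.+1 then tailA Q N.-1 else 0.
Proof.
rewrite /stepA /=.
have -> : (n%:Z - 1 < N%:Z) = (n <= N)%N by lia.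
by have -> : (n%:Z - 1 == N%:Z) = (n == N.+1) by lia.
Qed.

Lemma blkB_LItrunc n : blkB Q' n =
  if (n < N)%N then blkB Q n else if n == N then tailB Q N.-1 else 0.
Proof. by []. Qed.

Lemma stepA_LItrunc_ge0 n i j : 0 <= stepA Q' n i j.
Proof.
rewrite stepA_LItrunc; case: ifP => _; first by apply: stepA_ge0; exact: hP.1.
by case: ifP => _; [exact: tailA_ge0 | rewrite mxE].
Qed.

Lemma MG1mat_stepS Q1 k l (i j : 'I_M1) : (k <= l.+1)%N ->
  MG1mat (Q1 : blocks R M0 M1) (st k.+1 i) (st l.+1 j) = stepA Q1 (l.+1 - k)%N i j.
Proof.
move=> kl; rewrite /MG1mat/= /stepA; case: k kl i => [|k] kl i.
  by rewrite /= subr0 subn0 -addn1 PoszD addrK.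
by rewrite /= kl; congr (blkA Q1 _ i j); lia.
Qed.

Lemma LItrunc_ge0 s t : 0 <= MG1mat Q' s t.
Proof.
case: s t => [[|k] i] [[|l] j].
- exact: hP.1 (st 0 i) (st 0 j).
- have := hP.1 (st 0 i) (st l.+1 j); rewrite /MG1mat/=.
  by case: ifP => // _ _; case: ifP => _; [exact: tailB_ge0 | rewrite mxE].
- have := hP.1 (st k.+1 i) (st 0 j); by case: k i => [|k] i.
- have [kl|lk] := leqP k l.+1.
    by rewrite (MG1mat_stepS Q' i j kl) stepA_LItrunc_ge0.
  by case: k lk i => // k lk i; rewrite /MG1mat/= leqNgt lk mxE.
Qed.

(** Summing over all phases of both kinds gives one bound on the overshooting mass, valid for every
    starting state. *)
Definition trunc_tau : R := \sum_i (tailA Q N.-1 *m ones R M1) i 0 +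
  \sum_i (tailB Q N.-1 *m ones R M1) i 0.

(** The jumps of exactly N levels, where the truncation collects a whole tail; at all other
    positions its entries do not exceed those of the original matrix. *)
Let overshoot (s t : state M0 M1) : R :=
  if tag t == (tag s + N)%N then MG1mat Q' s t else 0.

Let overshoot_ge0 s t : 0 <= overshoot s t.
Proof. by rewrite /overshoot; case: ifP => // _; exact: LItrunc_ge0. Qed.

Let LItrunc_le s t : MG1mat Q' s t <= MG1mat Q s t + overshoot s t.
Proof.
rewrite /overshoot; case: eqP => [_|/eqP ne]; first by rewrite lerDr; exact: hP.1.
rewrite addr0; have := hP.1 s t; case: s t ne => [[|k] i] [[|l] j] //= ne.
- by rewrite /MG1mat/= (negbTE ne); case: ifP => // _; rewrite mxE.
- have [kl|lk] := leqP k l.+1.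
    rewrite !(MG1mat_stepS _ i j kl) stepA_LItrunc.
    case: ifP => // _; rewrite [_ == N.+1](_ : _ = false) ?mxE//.
    by apply/negP => /eqP e; move/negP: ne; apply; apply/eqP; lia.
  case: k lk ne i => // k lk ne i; rewrite /MG1mat/= leqNgt lk.
  by rewrite mxE.
Qed.

Let esum_overshoot s :
  (\esum_(t in [set: state M0 M1]) (overshoot s t)%:E <= trunc_tau%:E)%E.
Proof.
have -> : \esum_(t in [set: state M0 M1]) (overshoot s t)%:E =
    \esum_(t in [set t : state M0 M1 | tag t = (tag s + N)%N]) (MG1mat Q' s t)%:E.
  rewrite [RHS]esum_mkcond; apply: eq_esum => t _; rewrite /overshoot.
  by case: eqP => h; [rewrite mem_set | rewrite memNset].
rewrite esum_level; last by move=> t; exact: LItrunc_ge0.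
have A0 i : 0 <= (tailA Q N.-1 *m ones R M1) i 0.
  by rewrite mulmx_ones sumr_ge0// => j _; exact: tailA_ge0.
have B0 i : 0 <= (tailB Q N.-1 *m ones R M1) i 0.
  by rewrite mulmx_ones sumr_ge0// => j _; exact: tailB_ge0.
rewrite lee_fin /trunc_tau; move sL : (tag s + N)%N => L; case: L sL => [|L] sL.
  by clear -sL N0; lia.
case: s sL => [[|k] i] /= sL.
  rewrite add0n in sL; rewrite [X in _ + X](bigD1 i)//= addrCA.
  rewrite -[leLHS]addr0 lerD ?addr_ge0 ?sumr_ge0//.
  rewrite mulmx_ones; apply: ler_sum => j _; rewrite /MG1mat/= -sL sL /=.
  by rewrite ltnn eqxx.
rewrite [X in _ <= X + _](bigD1 i)//= -addrA -[leLHS]addr0 lerD ?addr_ge0 ?sumr_ge0//.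
rewrite mulmx_ones; apply: ler_sum => j _.
rewrite (MG1mat_stepS Q' i j (l := L)); last by clear -sL; lia.
rewrite stepA_LItrunc (_ : (L.+1 - k <= N)%N = false); last by clear -sL; lia.
by rewrite (_ : (L.+1 - k == N.+1)%N) //; clear -sL; lia.
Qed.

Lemma LItrunc_mean_le (f : state M0 M1 -> R) s : (forall t, 0 <= f t <= 1) ->
  (\esum_(t in [set: state M0 M1]) (MG1mat Q' s t * f t)%:E <=
   (mean (MG1mat Q s) f + trunc_tau)%:E)%E.
Proof.
move=> f1; have f0 t : 0 <= f t by case/andP: (f1 t).
rewrite EFinD (meanE (probability_vector_stochastic s hP) f1).
apply: le_trans (leeD2l _ (esum_overshoot s)).
rewrite -esumD; first last.
- by move=> t _; rewrite lee_fin.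
- by move=> t _; rewrite lee_fin mulr_ge0//; exact: hP.1.
apply: le_esum => t _; rewrite -EFinD lee_fin.
apply: (@le_trans _ _ ((MG1mat Q s t + overshoot s t) * f t)).
  by rewrite ler_wpM2r.
by rewrite mulrDl lerD2l ler_piMr//; case/andP: (f1 t).
Qed.

End Truncation.

Section RowConvergence.
Variable R : realType.

Definition row_cvg n (u : nat -> 'rV[R]_n) (l : 'rV[R]_n) : Prop :=
  forall i, (fun k => u k 0 i) @ \oo --> (l 0 i : R).

Lemma row_cvgMr m n (u : nat -> 'rV[R]_m) l (C : 'M[R]_(m, n)) : row_cvg u l ->
  row_cvg (fun k => u k *m C) (l *m C).
Proof.
move=> ul j; rewrite mxE; under eq_fun do rewrite mxE.
by apply: cvgn_sum => i _; apply: cvgM; [exact: ul | exact: cvg_cst].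
Qed.

Lemma row_cvgD n (u v : nat -> 'rV[R]_n) l m : row_cvg u l -> row_cvg v m ->
  row_cvg (fun k => u k + v k) (l + m).
Proof.
move=> ul vm j; rewrite mxE; under eq_fun do rewrite mxE.
by apply: cvgD; [exact: ul | exact: vm].
Qed.

Lemma row_cvgB n (u v : nat -> 'rV[R]_n) l m : row_cvg u l -> row_cvg v m ->
  row_cvg (fun k => u k - v k) (l - m).
Proof.
move=> ul vm j; rewrite [X in _ --> X]mxE [X in _ --> _ + X]mxE.
under eq_fun do rewrite mxE [X in _ + X]mxE.
by apply: cvgB; [exact: ul | exact: vm].
Qed.

Lemma row_cvgZ n (c : nat -> R) (r : R) (v : 'rV[R]_n) : c @ \oo --> r ->
  row_cvg (fun k => c k *: v) (r *: v).
Proof.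
move=> cr j; rewrite mxE; under eq_fun do rewrite mxE.
by apply: cvgM; [exact: cr | exact: cvg_cst].
Qed.

Lemma norm_mulmx_le n (v : 'rV[R]_n) (a : 'cV[R]_n) : (forall i, 0 <= v 0 i) ->
  `|(v *m a) 0 0| <= (\sum_i `|a i 0|) * (v *m ones R n) 0 0.
Proof.
move=> v0; rewrite mxE mulmx_ones mulr_sumr; apply: le_trans (ler_norm_sum _ _ _) _.
apply: ler_sum => i _; rewrite normrM ger0_norm// mulrC ler_wpM2r//.
by rewrite (bigD1 i)//= lerDl sumr_ge0.
Qed.

End RowConvergence.

(** * Crossing identities for the chain and its truncation *)

Section StationaryIdentities.
Variables (R : realType) (M0 M1 : nat) (Q : blocks R M0 M1) (w : 'rV[R]_M1).
Hypothesis hP : stochastic (MG1mat Q).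
Hypothesis hA : stochastic (fun i j => sumA Q i j).
Hypothesis hmA : forall i, (meanA Q i < +oo)%E.
Hypothesis hmB : forall i, (meanB Q i < +oo)%E.

Section Original.
Variable x : state M0 M1 -> R.
Hypothesis hx : stationary (MG1mat Q) x.

Let x0 : forall s, 0 <= x s. Proof. by case: hx. Qed.
Let x1 : \esum_(s in [set: state M0 M1]) (x s)%:E = 1%E. Proof. by case: hx. Qed.

Lemma stationary_level_crossing n :
  tail_levels x n + plevel x n *m stepA Q 0 =
  tail_levels x n *m sumA Q + level x 0 *m tailB Q n +
  \sum_(0 <= k < n) plevel x k *m tailA Q (n - k.+1)%N.
Proof.
apply: (@level_crossing _ _ _ (level x 0) (plevel x) (tail_levels x) (stepA Q)
  (tailA Q) (sumA Q) (fun l => blkB Q l.+1) (tailB Q)).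
- exact: plevel_ge0.
- exact: tail_levelsS.
- exact: tail_levels_cvg0.
- exact: plevel_cvg.
- exact: tailAS.
- exact: sumAE.
- exact: tailA_cvg0.
- exact: tailBS.
- exact: tailB_cvg0.
- by move=> l; exact: (level_balance l hP.1 hx).
Qed.

Lemma stationary_total_crossing n :
  (tail_levels x n *m (stepA Q 0 *m ones R M1)) 0 0 =
  (tail_levels x n *m excessA Q 0) 0 0 + (level x 0 *m excessB Q n) 0 0 +
  \sum_(0 <= k < n) (plevel x k *m excessA Q (n - k.+1)%N) 0 0.
Proof.
apply: (@total_crossing _ _ _ (level x 0) (plevel x) (tail_levels x) (stepA Q)
  (tailA Q) (sumA Q) (fun l => blkB Q l.+1) (tailB Q)).
- exact: plevel_ge0.
- exact: tail_levelsS.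
- exact: tail_levels_cvg0.
- exact: plevel_cvg.
- exact: tailAS.
- exact: sumAE.
- exact: tailA_cvg0.
- exact: tailBS.
- exact: tailB_cvg0.
- by move=> l; exact: (level_balance l hP.1 hx).
- exact: stochastic_mulmx_ones.
- exact: excessAS.
- exact: excessA_cvg0.
- exact: excessBS.
- exact: excessB_cvg0.
Qed.

End Original.

Section Truncated.
Variables (N : nat) (z : state M0 M1 -> R).
Hypothesis N0 : (0 < N)%N.
Hypothesis hz : stationary (MG1mat (LItrunc N Q)) z.

Let z0 : forall s, 0 <= z s. Proof. by case: hz. Qed.
Let z1 : \esum_(s in [set: state M0 M1]) (z s)%:E = 1%E. Proof. by case: hz. Qed.
Let Q' := LItrunc N Q.

(** Because the cut-off mass is placed at N, the tails are unchanged below N and vanish from N on,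
    and the sum of all A blocks is preserved. Summing these tails gives excesses reduced by their
    value at N, the source of the perturbation term. *)
Let Ab n : 'M[R]_M1 := if (n < N)%N then tailA Q n else 0.
Let Bb n : 'M[R]_(M0, M1) := if (n < N)%N then tailB Q n else 0.
Let D n : 'cV[R]_M1 := if (n < N)%N then excessA Q n - excessA Q N else 0.
Let DB n : 'cV[R]_M0 := if (n < N)%N then excessB Q n - excessB Q N else 0.

Let AbS n : Ab n = stepA Q' n.+2 + Ab n.+1.
Proof.
rewrite /Ab stepA_LItrunc//; case: (ltngtP n.+1 N) => h.
- by rewrite tailAS.
- by rewrite eqSS gtn_eqF// addr0.
- by rewrite -h eqxx addr0.
Qed.

Let Ab0 : sumA Q = stepA Q' 0 + stepA Q' 1 + Ab 0.
Proof. by rewrite /Ab !stepA_LItrunc// N0 sumAE. Qed.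

Let BbS n : Bb n = blkB Q' n.+1 + Bb n.+1.
Proof.
rewrite /Bb blkB_LItrunc; case: (ltngtP n.+1 N) => h.
- by rewrite tailBS.
- by rewrite addr0.
- by rewrite -h addr0.
Qed.

Let cut_cvg0 m n (C : nat -> 'M[R]_(m, n)) i j :
  (fun k => (if (k < N)%N then C k else 0) i j) @ \oo --> (0 : R).
Proof.
apply: cvg_near_cst; exists N => // k /= Nk.
by rewrite ltnNge Nk mxE.
Qed.

Let DS n : D n = Ab n *m ones R M1 + D n.+1.
Proof.
rewrite /D /Ab; case: (ltngtP n.+1 N) => h.
- by rewrite excessAS// addrA.
- by rewrite mul0mx addr0.
- by rewrite -h excessAS// addrK addr0.
Qed.

Let DBS n : DB n = Bb n *m ones R M1 + DB n.+1.
Proof.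
rewrite /DB /Bb; case: (ltngtP n.+1 N) => h.
- by rewrite excessBS// addrA.
- by rewrite mul0mx addr0.
- by rewrite -h excessBS// addrK addr0.
Qed.

Lemma truncated_level_crossing :
  tail_levels z 0 + plevel z 0 *m stepA Q 0 =
  tail_levels z 0 *m sumA Q + level z 0 *m tailB Q 0.
Proof.
have := @level_crossing _ _ _ (level z 0) (plevel z) (tail_levels z) (stepA Q')
  Ab (sumA Q) (fun l => blkB Q' l.+1) Bb (plevel_ge0 z0) (tail_levelsS z0 z1)
  (@tail_levels_cvg0 _ _ _ _ z0 z1) (@plevel_cvg _ _ _ _ z0 z1) AbS Ab0
  (fun i j => @cut_cvg0 _ _ (tailA Q) i j) BbS (fun i j => @cut_cvg0 _ _ (tailB Q) i j)
  (fun l => level_balance l (LItrunc_ge0 hP N0) hz) 0.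
by rewrite big_geq// addr0 /Bb N0 stepA_LItrunc.
Qed.

Lemma truncated_total_crossing :
  (tail_levels z 0 *m (stepA Q 0 *m ones R M1)) 0 0 =
  (tail_levels z 0 *m (excessA Q 0 - excessA Q N)) 0 0 +
  (level z 0 *m (excessB Q 0 - excessB Q N)) 0 0.
Proof.
have := @total_crossing _ _ _ (level z 0) (plevel z) (tail_levels z) (stepA Q')
  Ab (sumA Q) (fun l => blkB Q' l.+1) Bb (plevel_ge0 z0) (tail_levelsS z0 z1)
  (@tail_levels_cvg0 _ _ _ _ z0 z1) (@plevel_cvg _ _ _ _ z0 z1) AbS Ab0
  (fun i j => @cut_cvg0 _ _ (tailA Q) i j) BbS (fun i j => @cut_cvg0 _ _ (tailB Q) i j)
  (fun l => level_balance l (LItrunc_ge0 hP N0) hz) D DB (stochastic_mulmx_ones hA)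
  DS (fun i => @cut_cvg0 _ _ (fun n => excessA Q n - excessA Q N) i 0)
  DBS (fun i => @cut_cvg0 _ _ (fun n => excessB Q n - excessB Q N) i 0) 0.
by rewrite big_geq// addr0 /D /DB N0 stepA_LItrunc.
Qed.

End Truncated.

End StationaryIdentities.

(** * Asymptotics of the truncation error *)

Lemma cvgn0_dominated (R : realType) (u v : nat -> R) (C : R) :
  (forall n, `|u n| <= C * v n) -> v @ \oo --> (0 : R) -> u @ \oo --> (0 : R).
Proof.
move=> uv v0; have /cvgrPdist_le h := cvgn_mull0 C v0.
apply/cvgrPdist_le => e /h; apply: filterS => n /=; rewrite !sub0r !normrN.
by apply: le_trans; apply: le_trans (uv n) _; exact: ler_norm.
Qed.

Section Main.
Variables (R : realType) (M0 M1 : nat) (Q : blocks R M0 M1) (w : 'rV[R]_M1).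
Local Notation st k i := (existT (fun l => 'I_(lvl M0 M1 l)) k i : state M0 M1).
Hypotheses (hM0 : (0 < M0)%N) (hM1 : (0 < M1)%N).
Hypothesis hP : stochastic (MG1mat Q).
Hypothesis hPirr : irreducible_mat (MG1mat Q).
Hypothesis hA : stochastic (fun i j => sumA Q i j).
Hypothesis hAirr : irreducible_mat (fun i j => sumA Q i j).
Hypothesis hw : stationary (fun i j => sumA Q i j) (fun i => w 0 i).
Hypothesis hmB : forall i, (meanB Q i < +oo)%E.
Hypothesis hdrift : (drift Q w < 0)%E.

Let w0 : forall i, 0 < w 0 i := stationary_gt0 hA.1 hAirr hw.

Let meanA_lower i : ((- (stepA Q 0 *m ones R M1) i 0)%:E <= meanA Q i)%E.
Proof.
rewrite /meanA (_ : blkA Q (- 1) = stepA Q 0); last by rewrite /stepA sub0r.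
apply: leeDl; apply: nneseries_ge0 => k _ _.
by rewrite lee_fin mulr_ge0// mulmx_ones sumr_ge0// => j _; exact: blkA_ge0.
Qed.

(** Forced by the negative drift: all w i are positive and no entry of the mean is -oo, so an
    infinite entry would make the drift +oo. *)
Let hmA i : (meanA Q i < +oo)%E.
Proof.
rewrite ltey; apply/eqP => mi; move: hdrift; apply/negP; rewrite -leNgt.
rewrite /drift (bigD1 i)//= mi gt0_muley ?lte_fin//.
have h : ((\sum_(j | j != i) w 0 j * - (stepA Q 0 *m ones R M1) j 0)%:E <=
    \sum_(j | j != i) (w 0 j)%:E * meanA Q j)%E.
  rewrite -sumEFin; apply: lee_sum => j _; rewrite EFinM.
  by rewrite lee_wpmul2l// lee_fin ltW.
rewrite addye ?leey// -ltNye; exact: lt_le_trans (ltNyr _) h.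
Qed.

Let m : 'cV[R]_M1 := excessA Q 0 - stepA Q 0 *m ones R M1.
Let sigma : R := (w *m m) 0 0.

Let sigma_lt0 : sigma < 0.
Proof.
rewrite -lte_fin; suff <- : drift Q w = sigma%:E by [].
rewrite /drift /sigma mxE -sumEFin; apply: eq_bigr => i _.
by rewrite meanAE// EFinM.
Qed.

Section PoissonSolution.
Variable a : 'cV[R]_M1.
Hypothesis ha : a - sumA Q *m a = m - sigma *: ones R M1.

(* Adding the two crossing identities at level 0 leaves a linear functional of the
   levels 0 and 1 only, whose value on the stationary vector is - sigma. *)
Let v0 : 'cV[R]_M0 := excessB Q 0 + tailB Q 0 *m a - sigma *: ones R M0.
Let v1 : 'cV[R]_M1 := stepA Q 0 *m a.

(** The corrections [dA] and [dB] are zero for the original chain and the excesses at N for the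
    truncated one. *)
Let boundary_identity (y u1 : 'rV[R]_M1) (u0 : 'rV[R]_M0)
    (dA : 'cV[R]_M1) (dB : 'cV[R]_M0) :
  y + u1 *m stepA Q 0 = y *m sumA Q + u0 *m tailB Q 0 ->
  (y *m (stepA Q 0 *m ones R M1)) 0 0 =
    (y *m (excessA Q 0 - dA)) 0 0 + (u0 *m (excessB Q 0 - dB)) 0 0 ->
  (u0 *m ones R M0) 0 0 + (y *m ones R M1) 0 0 = 1 ->
  - sigma + ((y *m dA) 0 0 + (u0 *m dB) 0 0) = (u0 *m v0) 0 0 - (u1 *m v1) 0 0.
Proof.
have addE (v v' : 'M[R]_1) : (v + v') 0 0 = v 0 0 + v' 0 0 by rewrite mxE.
have oppE (v : 'M[R]_1) : (- v) 0 0 = - v 0 0 by rewrite mxE.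
have scaE c (v : 'M[R]_1) : (c *: v) 0 0 = c * v 0 0 by rewrite mxE.
move=> /(congr1 (fun v : 'rV_M1 => (v *m a) 0 0)).
have := congr1 (fun v : 'cV_M1 => (y *m v) 0 0) ha.
rewrite /= /v0 /v1 /m !(mulmxBr, mulmxDl, mulmxDr) -!scalemxAr !mulmxA.
rewrite !(addE, oppE, scaE) => e1 e2 e3 e4.
have : sigma * ((u0 *m ones R M0) 0 0 + (y *m ones R M1) 0 0) = sigma.
  by rewrite e4 mulr1.
lra.
Qed.

Section Original.
Variable x : state M0 M1 -> R.
Hypothesis hx : stationary (MG1mat Q) x.

Let x_gt0 : forall s, 0 < x s := stationary_gt0 hP.1 hPirr hx.
Let x_ge0 s : 0 <= x s. Proof. exact: ltW. Qed.
Let x_sum1 : \esum_(s in [set: state M0 M1]) (x s)%:E = 1%E. Proof. by case: hx. Qed.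

Let sigmaE : - sigma = (level x 0 *m v0) 0 0 - (plevel x 0 *m v1) 0 0.
Proof.
have := @boundary_identity (tail_levels x 0) (plevel x 0) (level x 0) 0 0.
rewrite !mulmx0 !subr0 [X in _ + (X + X)]mxE !addr0; apply.
- by have := stationary_level_crossing hP hx 0; rewrite big_geq// addr0.
- by have := stationary_total_crossing hP hA hmA hmB hx 0; rewrite big_geq// addr0.
- exact: total_mass.
Qed.

Let T n : R := (tail_levels x n *m ones R M1) 0 0.

Let TE n : T n = \sum_i tail_levels x n 0 i.
Proof. by rewrite /T mulmx_ones. Qed.

Let T_ge0 n : 0 <= T n.
Proof. by rewrite TE sumr_ge0// => i _; exact: tail_levels_ge0. Qed.

Let T_sub n : T n - T n.+1 = \sum_i plevel x n 0 i.
Proof.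
rewrite !TE -sumrB; apply: eq_bigr => i _.
by rewrite tail_levelsS// mxE addrK.
Qed.

(** The left side equals u a - q a, with u the flow into the levels above n from below and q the
    flow down out of them. Multiplying the level-crossing identity by ones shows that u and q have
    the same mass, and q has at most the mass of level n + 1; hence the constant, twice the sum of
    the absolute values of a. *)
Let renewal_equation n :
  `|- sigma * T n - ((level x 0 *m excessB Q n) 0 0 +
     \sum_(0 <= k < n) \sum_i plevel x k 0 i * excessA Q (n - k.+1)%N i 0)|
  <= (2 * \sum_i `|a i 0|) * (T n - T n.+1).
Proof.
have addE (v v' : 'M[R]_1) : (v + v') 0 0 = v 0 0 + v' 0 0 by rewrite mxE.
have oppE (v : 'M[R]_1) : (- v) 0 0 = - v 0 0 by rewrite mxE.
have scaE c (v : 'M[R]_1) : (c *: v) 0 0 = c * v 0 0 by rewrite mxE.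
pose u := level x 0 *m tailB Q n + \sum_(0 <= k < n) plevel x k *m tailA Q (n - k.+1)%N.
pose q := plevel x n *m stepA Q 0.
have lc : tail_levels x n + q = tail_levels x n *m sumA Q + u.
  by rewrite /q /u stationary_level_crossing// addrA.
have sumE : \sum_(0 <= k < n) \sum_i plevel x k 0 i * excessA Q (n - k.+1)%N i 0 =
    \sum_(0 <= k < n) (plevel x k *m excessA Q (n - k.+1)%N) 0 0.
  by apply: eq_bigr => k _; rewrite mxE.
have qu : (q *m ones R M1) 0 0 = (u *m ones R M1) 0 0.
  have := congr1 (fun v : 'rV_M1 => (v *m ones R M1) 0 0) lc.
  by rewrite /= !mulmxDl -mulmxA stochastic_mulmx_ones// !addE => /addrI.
have tc := stationary_total_crossing hP hA hmA hmB hx n.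
have loc : - sigma * T n - ((level x 0 *m excessB Q n) 0 0 +
     \sum_(0 <= k < n) \sum_i plevel x k 0 i * excessA Q (n - k.+1)%N i 0) =
   (u *m a) 0 0 - (q *m a) 0 0.
  rewrite sumE.
  have := congr1 (fun v : 'rV_M1 => (v *m a) 0 0) lc.
  have := congr1 (fun v : 'cV_M1 => (tail_levels x n *m v) 0 0) ha.
  move: tc; rewrite /= /m /T !(mulmxBr, mulmxDl, mulmxDr) -!scalemxAr !mulmxA.
  rewrite !(addE, oppE, scaE); lra.
have q0 i : 0 <= q 0 i.
  rewrite mxE sumr_ge0// => j _; rewrite mulr_ge0 ?plevel_ge0//.
  by apply: stepA_ge0; exact: hP.1.
have u0 i : 0 <= u 0 i.
  rewrite /u mxE summxE addr_ge0//.
    by rewrite mxE sumr_ge0// => j _; rewrite mulr_ge0 ?level_ge0 ?tailB_ge0.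
  rewrite sumr_ge0// => k _; rewrite mxE sumr_ge0// => j _.
  by rewrite mulr_ge0 ?plevel_ge0 ?tailA_ge0.
have qT : (q *m ones R M1) 0 0 <= T n - T n.+1.
  rewrite T_sub /q -mulmxA mxE; apply: ler_sum => i _.
  rewrite ler_piMr ?plevel_ge0// mulmx_ones.
  have <- : (sumA Q *m ones R M1) i 0 = 1 by rewrite stochastic_mulmx_ones// mxE.
  rewrite mulmx_ones; apply: ler_sum => j _; rewrite sumAE// -addrA mxE lerDl mxE.
  by rewrite addr_ge0 ?tailA_ge0//; apply: stepA_ge0; exact: hP.1.
rewrite loc; apply: le_trans (ler_normB _ _) _.
have h1 := norm_mulmx_le a u0; have h2 := norm_mulmx_le a q0.
have a0 : 0 <= \sum_i `|a i 0| by rewrite sumr_ge0.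
have := ler_wpM2l a0 qT; rewrite -qu in h1; lra.
Qed.

(** * Tail asymptotics of the stationary vector *)

Section Tail.
Variables (F : nat -> R) (cA : 'cV[R]_M1) (cB : 'cV[R]_M0).
Hypothesis hF : distribution_function F.
Hypothesis hFlong : long_tailed F.
Hypothesis hFsub : subexponential F.
Hypothesis hcA : forall i, 0 <= cA i 0.
Hypothesis hcB : forall i, 0 <= cB i 0.
Hypothesis hc : cA != 0 \/ cB != 0.
Hypothesis hlimA : forall i,
  (fun n => (ttailA Q n *m ones R M1) i 0 / tailF F n) @ \oo --> (cA i 0 : R).
Hypothesis hlimB : forall i,
  (fun n => (ttailB Q n *m ones R M1) i 0 / tailF F n) @ \oo --> (cB i 0 : R).
Let G := tailF F.

Let G_gt0 n : 0 < G n. Proof. by case: hFlong. Qed.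

Let G_step : (fun n => G n.+1 / G n) @ \oo --> (1 : R).
Proof. by case: hFlong => _ /(_ 1%N); under eq_fun do rewrite addn1. Qed.

Let ratio_pred (u : nat -> R) (l : R) : (fun n => u n / G n) @ \oo --> l ->
  (fun n => u n / G n.+1) @ \oo --> l.
Proof.
move=> ul; have -> : (fun n => u n / G n.+1) =
    (fun n => u n / G n * (G n.+1 / G n)^-1).
  by apply/funext => n; field; rewrite !gt_eqF.
suff : (fun n => u n / G n * (G n.+1 / G n)^-1) @ \oo --> l * 1^-1.
  by rewrite invr1 mulr1.
by apply: cvgM ul _; apply: cvgV; [exact: oner_neq0 | exact: G_step].
Qed.

Let ratio_shift (u : nat -> R) (l : R) : (fun n => u n.+1 / G n) @ \oo --> l ->
  (fun n => u n / G n) @ \oo --> l.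
Proof. by move=> /ratio_pred; rewrite (cvg_shiftS (fun n => u n / G n)). Qed.

Let excessA_ratio i : (fun n => excessA Q n i 0 / G n) @ \oo --> (cA i 0 : R).
Proof. by apply: ratio_shift; exact: hlimA. Qed.

Let excessB_ratio i : (fun n => excessB Q n i 0 / G n) @ \oo --> (cB i 0 : R).
Proof. by apply: ratio_shift; exact: hlimB. Qed.

Let mu : R := (level x 0 *m cB) 0 0 + (tail_levels x 0 *m cA) 0 0.

Let tail_ratio : (fun n => T n / G n) @ \oo --> mu / - sigma.
Proof.
rewrite /mu [X in _ + X]mxE.
apply: (@renewal_tail_cvg R F hF hFlong hFsub _ T (fun k i => plevel x k 0 i)
  _ _ (fun n => (level x 0 *m excessB Q n) 0 0) (fun i n => excessA Q n i 0)
  _ _ (2 * \sum_i `|a i 0|)).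
- by move=> k i; exact: plevel_ge0.
- exact: T_ge0.
- exact: T_sub.
- by move=> i; rewrite tail_levelsE; apply: tsum_cvg; exact: plevel_cvg.
- move=> n; rewrite mxE sumr_ge0// => i _; rewrite mulr_ge0 ?level_ge0//.
  exact: excessB_ge0.
- by move=> i n; exact: excessA_ge0.
- rewrite mxE; rewrite (_ : (fun n => _) = (fun n => \sum_i level x 0 0 i *
    (excessB Q n i 0 / G n))).
    by apply: cvgn_sum => i _; apply: cvgM; [exact: cvg_cst | exact: excessB_ratio].
  by apply/funext => n; rewrite mxE mulr_suml; apply: eq_bigr => i _; rewrite mulrA.
- exact: excessA_ratio.
- by rewrite oppr_gt0.
- by rewrite mulr_ge0// sumr_ge0.
- exact: renewal_equation.
Qed.

(** Irreducibility makes every entry of the stationary vector positive, so a single positive entry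
    of [cA] or [cB] suffices. The final ratio divides by a multiple of mu. *)
Let mu_gt0 : 0 < mu.
Proof.
have tl i : 0 < tail_levels x 0 0 i.
  rewrite tail_levelsS// mxE ltr_pwDl ?tail_levels_ge0// mxE; exact: x_gt0.
have h0 : 0 <= (level x 0 *m cB) 0 0.
  by rewrite mxE sumr_ge0// => i _; rewrite mulr_ge0 ?level_ge0.
have h1 : 0 <= (tail_levels x 0 *m cA) 0 0.
  by rewrite mxE sumr_ge0// => i _; rewrite mulr_ge0// ltW.
case: hc => [/cV0Pn|/cV0Pn] [i ci]; rewrite /mu.
  rewrite ltr_wpDl// mxE (bigD1 i)//= ltr_pwDl//.
    by rewrite mulr_gt0// lt_neqAle eq_sym ci hcA.
  by rewrite sumr_ge0// => j _; rewrite mulr_ge0// ltW.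
rewrite ltr_pwDl// mxE (bigD1 i)//= ltr_pwDl//.
  rewrite mulr_gt0//; first by rewrite mxE; exact: x_gt0.
  by rewrite lt_neqAle eq_sym ci hcB.
by rewrite sumr_ge0// => j _; rewrite mulr_ge0 ?level_ge0.
Qed.

(** * Stationary vectors of the truncated chains, with truncation level n + 1 *)

Variable z : nat -> state M0 M1 -> R.
Hypothesis hz : forall n, stationary (MG1mat (LItrunc n.+1 Q)) (z n).

Let z_ge0 n s : 0 <= z n s. Proof. by case: (hz n). Qed.
Let z_sum1 n : \esum_(s in [set: state M0 M1]) (z n s)%:E = 1%E. Proof. by case: (hz n). Qed.

Let tau n : R := trunc_tau Q n.+1.

Let tauE n : tau n = \sum_i (excessA Q n i 0 - excessA Q n.+1 i 0) +
  \sum_i (excessB Q n i 0 - excessB Q n.+1 i 0).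
Proof.
congr (_ + _); apply: eq_bigr => i _.
  by rewrite (excessAS hP hmA n) [in RHS]mxE addrK.
by rewrite (excessBS hP hmB n) [in RHS]mxE addrK.
Qed.

Let tau_cvg0 : tau @ \oo --> (0 : R).
Proof.
rewrite (funext tauE); apply: cvgn_add0; apply: cvgn_sum0 => i _; apply: cvgn_sub0.
- exact: excessA_cvg0.
- by rewrite (cvg_shiftS (fun n => excessA Q n i 0)); exact: excessA_cvg0.
- exact: excessB_cvg0.
- by rewrite (cvg_shiftS (fun n => excessB Q n i 0)); exact: excessB_cvg0.
Qed.

(** By long-tailedness both terms have the same limit relative to G, so increments of such a
    sequence are of smaller order than G. *)
Let sub_ratio_cvg0 (u : nat -> R) (l : R) : (fun n => u n / G n) @ \oo --> l ->
  (fun n => (u n - u n.+1) / G n.+1) @ \oo --> (0 : R).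
Proof.
move=> ul; under eq_fun do rewrite mulrBl.
suff : (fun n => u n / G n.+1 - u n.+1 / G n.+1) @ \oo --> l - l by rewrite subrr.
apply: cvgB; first exact: ratio_pred.
by rewrite (cvg_shiftS (fun n => u n / G n)).
Qed.

Let tau_ratio_cvg0 : (fun n => tau n / G n.+1) @ \oo --> (0 : R).
Proof.
rewrite (funext (fun n => congr1 (fun r => r / G n.+1) (tauE n))).
under eq_fun do rewrite mulrDl !mulr_suml.
apply: cvgn_add0; apply: cvgn_sum0 => i _; apply: sub_ratio_cvg0.
  exact: excessA_ratio.
exact: excessB_ratio.
Qed.

(** A reference state: z n splits into (1 + delta n) x, the multiple of x that agrees with it at
    [al], and a remainder [err]. *)
Let al : state M0 M1 := st 0 (Ordinal hM0).
Let err s n := z n s - z n al * (x s / x al).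
Let delta n := z n al / x al - 1.

Let err_le s : exists2 C, 0 <= C & forall n, `|err s n| <= C * tau n.
Proof.
have [C C0 h] := stationary_ratio_perturbation hP hPirr hx s al.
exists C => // n; apply: h (hz n) _ _.
- by move=> s' t; exact: LItrunc_ge0.
- rewrite /tau /trunc_tau addr_ge0// sumr_ge0// => i _; rewrite mulmx_ones sumr_ge0//.
    by move=> j _; exact: tailA_ge0.
  by move=> j _; exact: tailB_ge0.
- by move=> f s' f1; exact: LItrunc_mean_le.
Qed.

Let err_cvg0 s : err s @ \oo --> (0 : R).
Proof.
by have [C C0 h] := err_le s; exact: cvgn0_dominated h tau_cvg0.
Qed.

Let err_ratio_cvg0 s : (fun n => err s n / G n.+1) @ \oo --> (0 : R).
Proof.
have [C C0 h] := err_le s; apply: cvgn0_dominated tau_ratio_cvg0 => n.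
rewrite normrM (gtr0_norm (_ : 0 < (G n.+1)^-1)) ?invr_gt0//.
by rewrite mulrA ler_pM2r ?invr_gt0.
Qed.

Let z_sub s n : z n s - x s = x s * delta n + err s n.
Proof. by rewrite /delta /err; field; rewrite gt_eqF. Qed.

Let eps n := (tail_levels (z n) 0 *m excessA Q n.+1) 0 0 +
  (level (z n) 0 *m excessB Q n.+1) 0 0.

Let bdry (f : state M0 M1 -> R) : R := (level f 0 *m v0) 0 0 - (plevel f 0 *m v1) 0 0.

Let bdryE f : bdry f = \sum_i f (st 0 i) * v0 i 0 - \sum_i f (st 1 i) * v1 i 0.
Proof.
rewrite /bdry [X in X - _]mxE [X in _ - X]mxE.
by congr (_ - _); apply: eq_bigr => i _; rewrite mxE.
Qed.

Let bdry_cvg0 (f : state M0 M1 -> nat -> R) : (forall s, f s @ \oo --> (0 : R)) ->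
  (fun n => bdry (f^~ n)) @ \oo --> (0 : R).
Proof.
move=> f0; under eq_fun do rewrite bdryE.
apply: cvgn_sub0; apply: cvgn_sum0 => i _; under eq_fun do rewrite mulrC.
  by apply: cvgn_mull0; exact: f0.
by apply: cvgn_mull0; exact: f0.
Qed.

Let epsE n : - sigma + eps n = bdry (z n).
Proof.
apply: boundary_identity.
- exact: (@truncated_level_crossing _ _ _ _ hP n.+1 (z n) (ltn0Sn n) (hz n)).
- exact: (@truncated_total_crossing _ _ _ _ hP hA hmA hmB n.+1 (z n) (ltn0Sn n) (hz n)).
- exact: (total_mass (z_ge0 n) (z_sum1 n)).
Qed.

(** The functional [bdry] is linear and equals - sigma at x; inserting z n = (1 + delta n) x + err
    into [epsE] leaves a scalar equation for delta n. *)
Let deltaE n : delta n = (eps n - bdry (err^~ n)) / - sigma.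
Proof.
have : bdry (z n) = bdry x + (bdry x * delta n + bdry (err^~ n)).
  have zE s : z n s = x s + (x s * delta n + err s n) by rewrite -z_sub addrC subrK.
  rewrite !bdryE; under eq_bigr do rewrite zE mulrDl mulrDl.
  under [X in _ - X = _]eq_bigr do rewrite zE mulrDl mulrDl.
  rewrite !big_split/=.
  have e0 : \sum_i x (st 0 i) * delta n * v0 i 0 = (\sum_i x (st 0 i) * v0 i 0) * delta n.
    by rewrite mulr_suml; apply: eq_bigr => i _; rewrite mulrAC.
  have e1 : \sum_i x (st 1 i) * delta n * v1 i 0 = (\sum_i x (st 1 i) * v1 i 0) * delta n.
    by rewrite mulr_suml; apply: eq_bigr => i _; rewrite mulrAC.
  by rewrite e0 e1; lra.
rewrite -epsE {1 2}/bdry -sigmaE => /addrI ->.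
by rewrite addrK mulrAC divff ?mul1r// oppr_eq0 lt_eqF.
Qed.

Let z_tail_le1 n i : 0 <= tail_levels (z n) 0 0 i <= 1.
Proof.
rewrite tail_levels_ge0//= -(total_mass (z_ge0 n) (z_sum1 n)) !mulmx_ones.
rewrite [X in _ <= _ + X](bigD1 i)//= addrCA lerDl addr_ge0 ?sumr_ge0// => j _.
  exact: level_ge0.
exact: tail_levels_ge0.
Qed.

Let z_le1 n i : 0 <= level (z n) 0 0 i <= 1.
Proof.
rewrite level_ge0//= -(total_mass (z_ge0 n) (z_sum1 n)) !mulmx_ones.
rewrite [X in _ <= X + _](bigD1 i)//= -addrA lerDl addr_ge0 ?sumr_ge0// => j _.
  exact: level_ge0.
exact: tail_levels_ge0.
Qed.

Let bounded_mul_cvg0 (u v : nat -> R) : (forall n, 0 <= u n <= 1) ->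
  (forall n, 0 <= v n) -> v @ \oo --> (0 : R) -> (fun n => u n * v n) @ \oo --> (0 : R).
Proof.
move=> u01 vp v_0; apply: (squeeze_cvgr _ (cvg_cst 0) v_0); apply: nearW => n.
by case/andP: (u01 n) => ? ?; rewrite mulr_ge0//= ler_piMl.
Qed.

(** A rough version that uses only that the entries of z n lie in [0, 1]. It yields delta -> 0 and
    then convergence of z n to x, on which the sharp limit of eps relative to G depends. *)
Let eps_cvg0 : eps @ \oo --> (0 : R).
Proof.
apply: cvgn_add0; under eq_fun do rewrite mxE; apply: cvgn_sum0 => i _.
  apply: bounded_mul_cvg0 => [n|n|]; [exact: z_tail_le1 | exact: excessA_ge0 |].
  by rewrite (cvg_shiftS (fun n => excessA Q n i 0)); exact: excessA_cvg0.
apply: bounded_mul_cvg0 => [n|n|]; [exact: z_le1 | exact: excessB_ge0 |].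
by rewrite (cvg_shiftS (fun n => excessB Q n i 0)); exact: excessB_cvg0.
Qed.

Let delta_cvg0 : delta @ \oo --> (0 : R).
Proof.
rewrite (funext deltaE); under eq_fun do rewrite mulrC.
apply: cvgn_mull0; apply: cvgn_sub0; first exact: eps_cvg0.
exact: bdry_cvg0.
Qed.

Let z_cvg s : (fun n => z n s) @ \oo --> x s.
Proof.
have E n : z n s = x s + (x s * delta n + err s n) by rewrite -z_sub addrC subrK.
rewrite (funext E) -[X in _ --> X]addr0; apply: cvgD; first exact: cvg_cst.
by apply: cvgn_add0 (err_cvg0 s); apply: cvgn_mull0; exact: delta_cvg0.
Qed.

Let z_level_cvg k : row_cvg (fun n => level (z n) k) (level x k).
Proof. by move=> i; rewrite mxE; under eq_fun do rewrite mxE; exact: z_cvg. Qed.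

(* Multiplying the level-crossing identity by the fundamental matrix recovers the
   phase distribution off level 0 from the two boundary levels. *)
Let z_tail_cvg : row_cvg (fun n => tail_levels (z n) 0) (tail_levels x 0).
Proof.
pose rhs f : 'rV[R]_M1 := level f 0 *m tailB Q 0 - plevel f 0 *m stepA Q 0 +
  (1 - (level f 0 *m ones R M0) 0 0) *: w.
have key f y : y + plevel f 0 *m stepA Q 0 = y *m sumA Q + level f 0 *m tailB Q 0 ->
    (level f 0 *m ones R M0) 0 0 + (y *m ones R M1) 0 0 = 1 ->
    y = rhs f *m invmx (fundamental_mx (sumA Q) w).
  move=> e1 e2; rewrite -[LHS](mulmxK (fundamental_mx_unit hA hAirr hw)).
  congr (_ *m _); rewrite mul_fundamental_mx /rhs.
  have -> : 1 - (level f 0 *m ones R M0) 0 0 = (y *m ones R M1) 0 0.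
    by rewrite -e2 addrAC subrr add0r.
  congr (_ + _); apply/eqP; rewrite subr_eq addrAC -subr_eq opprK; apply/eqP.
  by rewrite e1 addrC.
have E n : tail_levels (z n) 0 = rhs (z n) *m invmx (fundamental_mx (sumA Q) w).
  apply: key; first exact: (@truncated_level_crossing _ _ _ _ hP n.+1 (z n) (ltn0Sn n) (hz n)).
    exact: (total_mass (z_ge0 n) (z_sum1 n)).
have -> : tail_levels x 0 = rhs x *m invmx (fundamental_mx (sumA Q) w).
  apply: key; last exact: total_mass.
  by have := stationary_level_crossing hP hx 0; rewrite big_geq// addr0.
rewrite (funext E); apply: row_cvgMr; apply: row_cvgD.
  apply: row_cvgB; apply: row_cvgMr; first exact: z_level_cvg.
  exact: (@z_level_cvg 1).
apply: row_cvgZ; apply: cvgB; first exact: cvg_cst.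
have h : row_cvg (fun n => (level (z n) 0 : 'rV_M0) *m ones R M0)
    ((level x 0 : 'rV_M0) *m ones R M0) by apply: row_cvgMr; exact: (@z_level_cvg 0).
exact: h.
Qed.

Let eps_ratio : (fun n => eps n / G n.+1) @ \oo --> mu.
Proof.
rewrite /mu addrC; under eq_fun do rewrite mulrDl.
apply: cvgD; under eq_fun do rewrite mxE mulr_suml; rewrite mxE;
  apply: cvgn_sum => i _; under eq_fun do rewrite -mulrA.
  apply: cvgM; first exact: z_tail_cvg.
  by rewrite (cvg_shiftS (fun n => excessA Q n i 0 / G n)); exact: excessA_ratio.
apply: cvgM; first exact: z_level_cvg.
by rewrite (cvg_shiftS (fun n => excessB Q n i 0 / G n)); exact: excessB_ratio.
Qed.

Let delta_ratio : (fun n => delta n / G n.+1) @ \oo --> mu / - sigma.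
Proof.
have E n : delta n / G n.+1 =
    (eps n / G n.+1 - bdry (fun s => err s n / G n.+1)) / - sigma.
  rewrite deltaE mulrAC mulrBl; congr ((_ - _) / _).
  rewrite !bdryE mulrBl !mulr_suml.
  by congr (_ - _); apply: eq_bigr => i _; rewrite mulrAC.
rewrite (funext E); apply: cvgM (cvg_cst _).
rewrite -[X in _ --> X]subr0; apply: cvgB; first exact: eps_ratio.
exact: (bdry_cvg0 (f := fun s n => err s n / G n.+1)).
Qed.

Let T_gt0 n : 0 < T n.
Proof.
rewrite TE (bigD1 (Ordinal hM1))//= ltr_pwDl//; last first.
  by rewrite sumr_ge0// => j _; exact: tail_levels_ge0.
rewrite tail_levelsS// mxE ltr_pwDl ?tail_levels_ge0// mxE; exact: x_gt0.
Qed.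

(** Both delta and the tail of x are asymptotically mu / (- sigma) times G, so this factor cancels
    and only x s remains. *)
Lemma approximation_ratio s :
  (fun n => (z n s - x s) / (tail_levels x n.+1 *m ones R M1) 0 0) @ \oo --> x s.
Proof.
have E n : (z n s - x s) / T n.+1 =
    (x s * (delta n / G n.+1) + err s n / G n.+1) / (T n.+1 / G n.+1).
  by rewrite z_sub; field; rewrite !gt_eqF.
have mus : mu / - sigma != 0.
  by rewrite mulf_eq0 invr_eq0 oppr_eq0 negb_or (gt_eqF mu_gt0) (lt_eqF sigma_lt0).
rewrite (funext E).
suff : (fun n => (x s * (delta n / G n.+1) + err s n / G n.+1) / (T n.+1 / G n.+1))
    @ \oo --> (x s * (mu / - sigma) + 0) / (mu / - sigma).
  by rewrite addr0 mulfK.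
apply: cvgM.
  by apply: cvgD; [apply: cvgM; [exact: cvg_cst | exact: delta_ratio] | exact: err_ratio_cvg0].
apply: cvgV => //.
by rewrite (cvg_shiftS (fun n => T n / G n)); exact: tail_ratio.
Qed.

End Tail.
End Original.
End PoissonSolution.

Lemma LItrunc_approximation_ratio (F : nat -> R) (cA : 'cV[R]_M1) (cB : 'cV[R]_M0)
    (x : state M0 M1 -> R) (z : nat -> state M0 M1 -> R) :
  stationary (MG1mat Q) x -> distribution_function F -> long_tailed F ->
  subexponential F -> (forall i, 0 <= cA i 0) -> (forall i, 0 <= cB i 0) ->
  cA != 0 \/ cB != 0 ->
  (forall i, (fun n => (ttailA Q n *m ones R M1) i 0 / tailF F n) @ \oo
     --> (cA i 0 : R)) ->
  (forall i, (fun n => (ttailB Q n *m ones R M1) i 0 / tailF F n) @ \oo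
     --> (cB i 0 : R)) ->
  (forall n, (0 < n)%N -> stationary (MG1mat (LItrunc n Q)) (z n)) ->
  forall s, (fun n => (z n s - x s) / (tail_levels x n *m ones R M1) 0 0) @ \oo --> x s.
Proof.
move=> hx hF hL hS hcA hcB hc hlA hlB hz s.
have [a ha] := poisson_equation hA hAirr hw (erefl sigma).
(* The shift discards the index 0, for which z is not assumed stationary. *)
rewrite -(cvg_shiftS (fun n => (z n s - x s) / (tail_levels x n *m ones R M1) 0 0)).
apply: (approximation_ratio ha hx hF hL hS hcA hcB hc hlA hlB (z := fun n => z n.+1)).
by move=> n; exact: hz.
Qed.

End Main.

Theorem corollary5p4 (R : realType) (M0 M1 : nat)
    (hM0 : (0 < M0)%N) (hM1 : (0 < M1)%N)
    (Q : blocks R M0 M1) (w : 'rV[R]_M1)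
    (hP : stochastic (MG1mat Q))
    (hPirr : irreducible_mat (MG1mat Q))
    (hA : stochastic (fun i j => sumA Q i j))
    (hAirr : irreducible_mat (fun i j => sumA Q i j))
    (hw : stationary (fun i j => sumA Q i j) (fun i => w 0 i))
    (hmB : forall i, (meanB Q i < +oo)%E)
    (hdrift : (drift Q w < 0)%E)
    (F : nat -> R) (cA : 'cV[R]_M1) (cB : 'cV[R]_M0)
    (hF : distribution_function F)
    (hFlong : long_tailed F)
    (hcA : forall i, 0 <= cA i 0)
    (hcB : forall i, 0 <= cB i 0)
    (hc : cA != 0 \/ cB != 0)
    (hlimA : forall i,
      (fun N : nat => (ttailA Q N *m ones R M1) i 0 / tailF F N) @ \oo
        --> (cA i 0 : R))
    (hlimB : forall i,
      (fun N : nat => (ttailB Q N *m ones R M1) i 0 / tailF F N) @ \oo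
        --> (cB i 0 : R))
    (x : state M0 M1 -> R) (hx : stationary (MG1mat Q) x)
    (xN : nat -> state M0 M1 -> R)
    (hxN : forall N : nat, (0 < N)%N ->
      stationary (MG1mat (LItrunc N Q)) (xN N))
    (hFsub : subexponential F) :
  forall k : nat,
    (forall i : 'I_(lvl M0 M1 k),
      (fun N : nat => (level (xN N) k - level x k) 0 i
                        / (tail_levels x N *m ones R M1) 0 0) @ \oo
        --> (level x k 0 i : R)) /\
    ((fun N : nat =>
        ((tail_levels x N *m ones R M1) 0 0)^-1
        * l1norm (((level x k *m ones R (lvl M0 M1 k)) 0 0)^-1
                    *: (level (xN N) k - level x k))) @ \oo
      --> (1 : R)).
Proof.
have ratio := LItrunc_approximation_ratio hM0 hM1 hP hPirr hA hAirr hw hmB hdrift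
  hx hF hFlong hFsub hcA hcB hc hlimA hlimB hxN.
have x_gt0 := stationary_gt0 hP.1 hPirr hx.
have x_ge0 s : 0 <= x s by exact: ltW.
have x_sum1 : \esum_(s in [set: state M0 M1]) (x s)%:E = 1%E by case: hx.
move=> k.
have ratio_k (i : 'I_(lvl M0 M1 k)) :
    (fun N : nat => (level (xN N) k - level x k) 0 i
       / (tail_levels x N *m ones R M1) 0 0) @ \oo --> (level x k 0 i : R).
  rewrite [X in _ --> X]mxE.
  under eq_fun do rewrite mxE [X in X + _]mxE [X in _ + X]mxE [X in _ - X]mxE.
  exact: ratio.
split=> //.
pose c := (level x k *m ones R (lvl M0 M1 k)) 0 0.
have c_gt0 : 0 < c.
  have [i0 _] : exists i : 'I_(lvl M0 M1 k), true.
    by case: (k) => [|k']; [exists (Ordinal hM0) | exists (Ordinal hM1)].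
  rewrite /c mulmx_ones (bigD1 i0)//= ltr_pwDl ?mxE//.
  by rewrite sumr_ge0// => i _; rewrite mxE.
have T_ge0 N : 0 <= (tail_levels x N *m ones R M1) 0 0.
  by rewrite mulmx_ones sumr_ge0// => i _; exact: tail_levels_ge0.
have normE N : ((tail_levels x N *m ones R M1) 0 0)^-1
        * l1norm (c^-1 *: (level (xN N) k - level x k)) =
    \sum_i c^-1 * `|(level (xN N) k - level x k) 0 i
      / (tail_levels x N *m ones R M1) 0 0|.
  rewrite /l1norm [X in _ * X]mulmx_ones mulr_sumr; apply: eq_bigr => i _.
  have -> : map_mx Num.norm (c^-1 *: (level (xN N) k - level x k)) 0 i =
      c^-1 * `|(level (xN N) k - level x k) 0 i|.
    by rewrite mxE [X in `|X|]mxE normrM (gtr0_norm (_ : 0 < c^-1)) ?invr_gt0.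
  by rewrite normrM normfV (ger0_norm (T_ge0 N)) mulrC -mulrA.
rewrite (funext normE).
(* The limit 1 is written as the norm of the normalised level of x, so that the norm statement
   follows from the entrywise one by continuity of the absolute value. *)
have -> : (1 : R) = \sum_i c^-1 * `|level x k 0 i|.
  rewrite -mulr_sumr (eq_bigr (fun i => level x k 0 i)).
    by rewrite -mulmx_ones -/c mulVf// gt_eqF.
  by move=> i _; rewrite ger0_norm// mxE.
apply: cvgn_sum => i _; apply: cvgM; first exact: cvg_cst.
by apply: cvg_norm; exact: ratio_k.
Qed.
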